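(* Let $0\le p<q\le\infty$. Then the following conditions are equivalent: (i) $(\ell^p,\ell^q)$ is a Calderón–Mityagin couple; (ii) $(\ell^p,\ell^q)$ is a uniform Calderón–Mityagin couple; (iii) $q\ge1$.
   Context: All sequences are real. For $0<p<\infty$, $\|x\|_{\ell^p}=(\sum_k|x_k|^p)^{1/p}$; $\ell^\infty$ has the sup norm; $\ell^0$ is the linear space of eventually zero sequences with $\|x\|_{\ell^0}:=\mathrm{card}\{k:x_k\ne0\}$. Put $\|T\|_{X\to X}:=\sup_{x\ne0}\|Tx\|_X/\|x\|_X$. For $0\le p<q\le\infty$ (so $\ell^p\subset\ell^q$), $\mathfrak{L}(\ell^p,\ell^q)$ is the set of bounded linear operators $T$ on $\ell^q$ whose restriction to $\ell^p$ is a bounded map of $\ell^p$ into itself, and $\|T\|_{\mathfrak{L}(\ell^p,\ell^q)}:=\max(\|T\|_{\ell^p\to\ell^p},\|T\|_{\ell^q\to\ell^q})$. For $x\in\ell^q$ and $t>0$, $\mathcal{K}(t,x;\ell^p,\ell^q):=\inf\{\|x_0\|_{\ell^p}+t\|x_1\|_{\ell^q}:x=x_0+x_1,\ x_0\in\ell^p,\ x_1\in\ell^q\}$. For $x\neq 0$, $\mathcal{K}\text{-}\mathrm{Orb}(x;\ell^p,\ell^q)$ is the set of $y\in\ell^q$ with $\|y\|_{\mathcal{K}\text{-}\mathrm{Orb}(x)}:=\sup_{t>0}\mathcal{K}(t,y;\ell^p,\ell^q)/\mathcal{K}(t,x;\ell^p,\ell^q)<\infty$. $(\ell^p,\ell^q)$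 is a Calderón–Mityagin couple if for every nonzero $x\in\ell^q$ and every $y\in\mathcal{K}\text{-}\mathrm{Orb}(x;\ell^p,\ell^q)$ there is $T\in\mathfrak{L}(\ell^p,\ell^q)$ with $y=Tx$. It is a uniform Calderón–Mityagin couple if, additionally, there is a constant $C$ independent of $x,y$ such that $T$ can be chosen with $\|T\|_{\mathfrak{L}(\ell^p,\ell^q)}\le C\|y\|_{\mathcal{K}\text{-}\mathrm{Orb}(x)}$ (for $p>0$); by homogeneity this is equivalent to requiring that whenever $\mathcal{K}(t,y;\ell^p,\ell^q)\le\mathcal{K}(t,x;\ell^p,\ell^q)$ for all $t>0$, there is $T$ with $Tx=y$ and $\|T\|_{\mathfrak{L}(\ell^p,\ell^q)}\le C$. For $p=0$, where $\|\cdot\|_{\ell^0}$ is not homogeneous, the additional requirement is taken in this last (normalized) form. *)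

(* Defs.v *)
From HB Require Import structures.
From mathcomp Require Import all_boot all_order all_algebra.
From mathcomp Require Import all_classical all_reals all_analysis.

Set Implicit Arguments.
Unset Strict Implicit.
Unset Printing Implicit Defensive.

Import Order.TTheory GRing.Theory Num.Theory.
Import numFieldNormedType.Exports.

Local Open Scope classical_set_scope.
Local Open Scope ring_scope.
Local Open Scope ereal_scope.

Section SequenceSpaces.
Context {R : realType}.
Implicit Types (p q : \bar R) (x y : R^nat) (t : R) (T : R^nat -> R^nat).

(* [Lnorm] at exponent 0 is not the cardinality of the support, hence the case
   distinction. *)
Definition lnorm p x : \bar R :=
  if p == 0 then counting [set k | x k != 0%R]
  else 'N[counting]_p [EFin \o x].

(* At p = 0 this is finiteness of the support. *)
Definition lspace p : set (R^nat) := [set x | lnorm p x < +oo].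

Definition opnorm p T : \bar R :=
  ereal_sup [set lnorm p (T x) / lnorm p x | x in lspace p `\ 0%R].

(* An operator on l^q is given by a map on all sequences; everything below
   depends only on its values on l^q. *)
Definition linear_on q T : Prop :=
  forall (a : R) x y, lspace q x -> lspace q y ->
    T (a *: x + y)%R = (a *: T x + T y)%R.

Definition bounded_on p T : Prop :=
  (forall x, lspace p x -> lspace p (T x)) /\ opnorm p T < +oo.

Definition couple_op p q : set (R^nat -> R^nat) :=
  [set T | [/\ linear_on q T, bounded_on q T & bounded_on p T]].

Definition couple_opnorm p q T : \bar R := maxe (opnorm p T) (opnorm q T).

Definition Kfun p q t x : \bar R :=
  ereal_inf [set lnorm p z.1 + t%:E * lnorm q z.2 | z in
    [set z : R^nat * R^nat |
      [/\ lspace p z.1, lspace q z.2 & x = (z.1 + z.2)%R]]].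

Definition Korb_norm p q x y : \bar R :=
  ereal_sup [set Kfun p q t y / Kfun p q t x | t in [set t | (0 < t)%R]].

Definition Korb p q x : set (R^nat) :=
  [set y | lspace q y /\ Korb_norm p q x y < +oo].

Definition CM_couple p q : Prop :=
  forall x, lspace q x -> x <> 0%R -> forall y, Korb p q x y ->
    exists2 T, couple_op p q T & y = T x.

(* Since the l^0 functional is not homogeneous, for p = 0 the uniform bound is
   imposed only on pairs normalized by K(t, y) <= K(t, x). *)
Definition uniform_CM_couple p q : Prop :=
  CM_couple p q /\
  if p == 0 then
    exists C : R, forall x y, lspace q x -> lspace q y ->
      (forall t, (0 < t)%R -> Kfun p q t y <= Kfun p q t x) ->
      exists T, [/\ couple_op p q T, y = T x & couple_opnorm p q T <= C%:E]
  else
    exists C : R, forall x, lspace q x -> x <> 0%R ->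
      forall y, Korb p q x y ->
      exists T, [/\ couple_op p q T, y = T x &
                    couple_opnorm p q T <= C%:E * Korb_norm p q x y].

End SequenceSpaces.

(* Main.v *)
Require Import Defs.
From mathcomp Require Import all_boot all_order all_algebra finmap.
From mathcomp Require Import all_classical all_reals all_analysis.
From mathcomp Require Import ring lra.

Set Implicit Arguments.
Unset Strict Implicit.
Unset Printing Implicit Defensive.

Import Order.TTheory GRing.Theory Num.Theory.
Import numFieldNormedType.Exports.

Local Open Scope classical_set_scope.
Local Open Scope ring_scope.

(** Write [Phi_p x] for the sum of the [|x_k|^p] (the number of nonzero entries if
    [p = 0]), here [modular p x].

    For [q >= 1] the operator is built from a comparison of sizes. When [q] is
    finite, splitting [x] at height [s] is nearly optimal for the K-functional, so
    that domination of K-functionals gives, up to constants, domination for every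
    [s > 0] of the level sums
      [sum over |x_k| >= s of |x_k|^p + s^(p-q) * sum over |x_k| < s of |x_k|^q]
    ([level_sum_domination]). Hence at each height either the heads of [x] and [y]
    are comparable in [Phi_p], or their tails are comparable in [Phi_q]
    ([level_dichotomy]). This sorts the entries [y_j] into two classes, according
    to which alternative holds at height [|y_j|].

    In the first class each [y_j] is charged to a single larger entry [x_k], so
    that the entries charged to [x_k] have total [p]-mass at most a constant times
    [|x_k|^p] ([head_matching]); sending [u] to [(y_j / x_k) u_k] is then bounded
    on l^r for all [r >= p]. In the second class each [y_j] receives a block of
    smaller entries of [x] of [q]-mass at least [|y_j|^q], and each entry of [x] is
    used a bounded number of times ([tail_matching]); averaging
    [(y_j / x_k) u_k] over the block with weights proportional to [|x_k|^q] is
    bounded on l^r for all [r <= q], provided that [q >= 1]. The sum of these two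
    operators is bounded on l^p and on l^q, and maps [x] to [y]
    ([factorization]). For [q = oo] only the heads matter.

    For [q < 1] let [b] be a decreasing sequence in l^q with [Phi_p b] infinite,
    and let [x] be obtained by spreading each [b_m] evenly over [N_m] places
    without changing its l^q norm. Taking l^q norms of blocks is not linear, but it
    respects decompositions, so [b] lies in the K-orbit of [x]
    ([Kfun_block_norms]). On the other hand an operator bounded on l^q with
    [q < 1] is bounded from l^1 to the sup norm ([coord_le_l1]), and the l^1 norms
    of the blocks are as small as desired. Choosing the [N_m] large enough
    ([spreading_data]), the first [J] blocks would have to produce, up to a factor
    2, many more entries of [b] than boundedness on l^p permits
    ([not_CM_couple_lt1]). *)

(** * Powers with exponent 0 allowed *)

Section Gauge.
Context {R : realType}.
Implicit Types (p q r a b : R).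

(** At [p = 0] this is the indicator of [a != 0], which lets l^0 be treated along
    with the other exponents; [`|a| `^ 0] would be 1 at [a = 0] as well. *)
Definition gauge p a : R := if a == 0 then 0 else `|a| `^ p.

Lemma gauge_ge0 p a : 0 <= gauge p a.
Proof. by rewrite /gauge; case: ifP => // _; exact: powR_ge0. Qed.

Lemma gauge0 p : gauge p 0 = 0.
Proof. by rewrite /gauge eqxx. Qed.

Lemma gauge_eq0 p a : (gauge p a == 0) = (a == 0).
Proof.
rewrite /gauge; case: ifPn => [_|a0]; first by rewrite eqxx.
by rewrite powR_eq0 normr_eq0 (negbTE a0).
Qed.

Lemma gauge_gt0 p a : a != 0 -> 0 < gauge p a.
Proof. by move=> a0; rewrite lt_neqAle gauge_ge0 andbT eq_sym gauge_eq0. Qed.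

Lemma gaugeE p a : 0 < p -> gauge p a = `|a| `^ p.
Proof.
move=> p0; rewrite /gauge; case: eqVneq => // ->.
by rewrite normr0 powR0 // gt_eqF.
Qed.

Lemma gauge_neq0 p a : a != 0 -> gauge p a = `|a| `^ p.
Proof. by rewrite /gauge => /negbTE ->. Qed.

Lemma gaugeM p a b : gauge p (a * b) = gauge p a * gauge p b.
Proof.
have [->|a0] := eqVneq a 0; first by rewrite mul0r gauge0 mul0r.
have [->|b0] := eqVneq b 0; first by rewrite mulr0 gauge0 mulr0.
by rewrite /gauge mulf_eq0 (negbTE a0) (negbTE b0) normrM powRM.
Qed.

Lemma ler_gauge p a b : 0 <= p -> `|a| <= `|b| -> gauge p a <= gauge p b.
Proof.
move=> p0 ab; have [->|a0] := eqVneq a 0; first by rewrite gauge0 gauge_ge0.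
have b0 : b != 0.
  by apply: contra_neq a0 => b0; apply/eqP; rewrite -normr_le0 (le_trans ab) // b0 normr0.
by rewrite !gauge_neq0 // ge0_ler_powR // nnegrE normr_ge0.
Qed.

Lemma gauge_le1 p a : 0 <= p -> `|a| <= 1 -> gauge p a <= 1.
Proof.
move=> p0 a1; have -> : 1 = gauge p (1 : R).
  by rewrite gauge_neq0 ?oner_eq0 // normr1 powR1.
by apply: ler_gauge => //; rewrite normr1.
Qed.

Lemma ler_gauge_exp p q a : p <= q -> `|a| <= 1 -> gauge q a <= gauge p a.
Proof.
move=> pq a1; have [->|a0] := eqVneq a 0; first by rewrite !gauge0.
by rewrite !gauge_neq0 // ger_powR // normr_gt0 a0.
Qed.

Lemma gauge_gauge p q a : 0 <= p -> 0 < q -> gauge (p / q) (gauge q a) = gauge p a.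
Proof.
move=> p0 q0; have [->|a0] := eqVneq a 0; first by rewrite !gauge0.
rewrite gauge_neq0 ?gauge_eq0 // ger0_norm ?gauge_ge0 //.
by rewrite !gauge_neq0 // -powRrM mulrCA divff ?mulr1 // gt_eqF.
Qed.

Lemma powR_subadd p a b : 0 < p <= 1 -> 0 <= a -> 0 <= b ->
  (a + b) `^ p <= a `^ p + b `^ p.
Proof.
move=> /andP[p0 p1] a0 b0; have [ab0|ab0] := eqVneq (a + b) 0.
  by rewrite ab0 powR0 ?gt_eqF // addr_ge0 ?powR_ge0.
have s0 : 0 < a + b by rewrite lt_neqAle eq_sym ab0 addr_ge0.
have key c : 0 <= c -> c <= a + b -> c / (a + b) * (a + b) `^ p <= c `^ p.
  move=> c0 cs; have {2}-> : c = c / (a + b) * (a + b) by rewrite divfK.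
  rewrite (@powRM _ _ (a + b)) ?divr_ge0 // ?(ltW s0) //.
  rewrite ler_wpM2r ?powR_ge0 //.
  have [->|cN0] := eqVneq c 0; first by rewrite mul0r powR0 ?gt_eqF.
  rewrite ger1_powR // divr_gt0 ?(lt_neqAle 0 c) ?(eq_sym 0 c) ?cN0 //=.
  by rewrite ler_pdivrMr // mul1r.
have -> : (a + b) `^ p = a / (a + b) * (a + b) `^ p + b / (a + b) * (a + b) `^ p.
  by rewrite -mulrDl -mulrDl divff // mul1r.
by apply: lerD; apply: key; rewrite ?lerDl ?lerDr.
Qed.

Lemma gauge_subadd p a b : 0 <= p <= 1 -> gauge p (a + b) <= gauge p a + gauge p b.
Proof.
move=> /andP[p0 p1]; have [->|a0] := eqVneq a 0.
  by rewrite add0r gauge0 add0r.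
have [->|b0] := eqVneq b 0; first by rewrite addr0 gauge0 addr0.
move: p0; rewrite le_eqVlt => /predU1P[<-|p0].
  rewrite (gauge_neq0 _ a0) (gauge_neq0 _ b0) /gauge !powRr0.
  by case: ifP => _; rewrite ?lerDl ?addr_ge0.
rewrite !gaugeE //; apply: le_trans (powR_subadd _ _ _); rewrite ?p0 //.
by rewrite ge0_ler_powR ?nnegrE ?addr_ge0 // ?ler_normD // ltW.
Qed.

Lemma gauge_sum_subadd p (I : Type) (s : seq I) (P : pred I) (f : I -> R) :
  0 <= p <= 1 ->
  gauge p (\sum_(i <- s | P i) f i) <= \sum_(i <- s | P i) gauge p (f i).
Proof.
move=> p01; elim/big_ind2: _ => //; first by rewrite gauge0.
by move=> x1 x2 y1 y2 h1 h2; apply: le_trans (gauge_subadd _ _ p01) (lerD h1 h2).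
Qed.

(** Bernoulli's inequality: Young's inequality [a b <= a^r / r + b^r' / r'] at
    [b = 1]. *)
Lemma powR_ge_tangent r a : 1 <= r -> 0 <= a -> 1 + r * (a - 1) <= a `^ r.
Proof.
rewrite le_eqVlt => /predU1P[<-|r1] a0; first by rewrite powRr1 // mul1r subrKC.
have r0 : 0 < r by apply: lt_trans r1.
have r'0 : 0 < 1 - r^-1 by rewrite subr_gt0 invf_lt1.
have := @conjugate_powR R a 1 r (1 - r^-1)^-1 a0 ler01 r0.
rewrite invr_gt0 invrK subrKC => /(_ r'0 erefl).
rewrite mulr1 powR1 mul1r => h.
have : r * a <= r * (a `^ r / r + (1 - r^-1)) by rewrite ler_pM2l.
rewrite mulrDr mulrCA divff ?gt_eqF // mulr1 mulrBr mulr1 divff ?gt_eqF //.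
lra.
Qed.

(** The power lies above its tangent at the mean [m]; the linear terms of the
    tangent cancel in the weighted sum. *)
Lemma powR_jensen r (I : Type) (s : seq I) (w v : I -> R) : 1 <= r ->
  (forall i, 0 <= w i) -> (forall i, 0 <= v i) -> \sum_(i <- s) w i = 1 ->
  (\sum_(i <- s) w i * v i) `^ r <= \sum_(i <- s) w i * v i `^ r.
Proof.
move=> r1 w0 v0 w1; set m := \sum_(i <- s) w i * v i.
have r0 : 0 < r by apply: lt_le_trans r1.
have m0 : 0 <= m by apply: sumr_ge0 => i _; rewrite mulr_ge0.
have [mE|mN0] := eqVneq m 0.
  by rewrite mE powR0 ?gt_eqF // sumr_ge0 // => i _; rewrite mulr_ge0 ?powR_ge0.
have -> : m `^ r = \sum_(i <- s) w i * (m `^ r * (1 + r * (v i / m - 1))).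
  have E i : w i * (m `^ r * (1 + r * (v i / m - 1))) =
      m `^ r * ((1 - r) * w i + r / m * (w i * v i)) by field.
  under eq_bigr do rewrite E.
  rewrite -mulr_sumr big_split /= -!mulr_sumr w1 -/m -[_ / m * m]mulrA mulVf //.
  by rewrite !mulr1 subrK mulr1.
apply: ler_sum => i _; rewrite ler_wpM2l //.
have {2}-> : v i = m * (v i / m) by rewrite mulrCA divff ?mulr1.
rewrite (powRM r) ?divr_ge0 // ler_wpM2l ?powR_ge0 //.
by apply: powR_ge_tangent => //; rewrite divr_ge0.
Qed.

End Gauge.

(** * Sums of nonnegative families *)

Section Sums.
Context {R : realType}.
Local Open Scope ereal_scope.
Implicit Types (T : choiceType).

Lemma esum_subset T (I J : set T) (f : T -> \bar R) : (forall k, 0 <= f k) ->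
  I `<=` J -> \esum_(k in I) f k <= \esum_(k in J) f k.
Proof.
move=> f0 IJ; rewrite esum_mkcond [leRHS]esum_mkcond; apply: le_esum => k _.
case: ifPn => [|_]; last by case: ifP.
by rewrite inE => /IJ Jk; rewrite ifT // inE.
Qed.

Lemma sum_le_esum T (I : set T) (f : T -> R) (s : seq T) :
  (forall k, (0 <= f k)%R) -> uniq s -> (forall k, k \in s -> I k) ->
  (\sum_(k <- s) f k)%:E <= \esum_(k in I) (f k)%:E.
Proof.
move=> f0 us sI; apply: esum_ge; exists [set` s].
  by split; [exact: finite_seq | move=> k /= ks; exact: sI].
by rewrite /= -fsbig_seq // sumEFin.
Qed.

Lemma esum_le_fin T (I : set T) (f : T -> R) (c : \bar R) :
  (forall s, uniq s -> (forall k, k \in s -> I k) -> (\sum_(k <- s) f k)%:E <= c) ->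
  \esum_(k in I) (f k)%:E <= c.
Proof.
move=> h; apply: ge_ereal_sup => _ [F [finF FI] <-].
rewrite fsbig_finite //= sumEFin; apply: h => [|k]; first exact: fset_uniq.
by rewrite in_fset_set // inE => /FI.
Qed.

Lemma esum_le_ord (f : nat -> R) (c : \bar R) : (forall k, (0 <= f k)%R) ->
  (forall n, (\sum_(k < n) f k)%:E <= c) -> \esum_(k in setT) (f k)%:E <= c.
Proof.
move=> f0 h; rewrite -nneseries_esumT => [|n]; last by rewrite lee_fin.
apply: lime_le; first by apply: is_cvg_nneseries => n _ _; rewrite lee_fin.
by apply: nearW => n; rewrite big_mkord sumEFin.
Qed.

Lemma sum_ord_le_esum (f : nat -> R) n : (forall k, (0 <= f k)%R) ->
  (\sum_(k < n) f k)%:E <= \esum_(k in setT) (f k)%:E.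
Proof.
move=> f0; rewrite -(big_mkord xpredT f) /index_iota subn0.
by apply: sum_le_esum; rewrite ?iota_uniq.
Qed.

Lemma esumZl T (I : set T) (c : R) (f : T -> \bar R) : (0 <= c)%R ->
  (forall k, 0 <= f k) ->
  \esum_(k in I) (c%:E * f k) = c%:E * \esum_(k in I) f k.
Proof.
move=> + f0.
have le (c' : R) (g : T -> \bar R) : (0 < c')%R -> (forall k, 0 <= g k) ->
    \esum_(k in I) (c'%:E * g k) <= c'%:E * \esum_(k in I) g k.
  move=> c0 g0; apply: ge_ereal_sup => _ [F [finF FI] <-].
  rewrite fsbig_finite //= -ge0_sume_distrr // lee_pmul2l ?fin_numE //.
  by apply: esum_ge; exists F => //; rewrite fsbig_finite.
rewrite le_eqVlt => /predU1P[<-|c0].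
  by rewrite mul0e esum1 // => k _; rewrite mul0e.
apply/eqP; rewrite eq_le le //=.
have := le c^-1%R (fun k => c%:E * f k).
have cf0 k : 0 <= c%:E * f k by rewrite mule_ge0 ?lee_fin ?(ltW c0).
rewrite invr_gt0 => /(_ c0 cf0).
under eq_esum do rewrite muleA -EFinM mulVf ?gt_eqF // mul1e.
by rewrite lee_pdivlMl.
Qed.

Lemma esum_lty T (I : set T) (f : T -> R) : (forall k, (0 <= f k)%R) ->
  finite_set I -> \esum_(k in I) (f k)%:E < +oo.
Proof.
move=> f0 fI; rewrite esum_fset => [|//|i _]; last by rewrite lee_fin.
by rewrite fsbig_finite //= sumEFin ltry.
Qed.

Lemma esum_ge_infinite T (I : set T) (f : T -> R) (c : R) :
  (forall k, (0 <= f k)%R) -> (0 < c)%R -> (forall k, I k -> (c <= f k)%R) ->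
  infinite_set I -> \esum_(k in I) (f k)%:E = +oo.
Proof.
move=> f0 c0 cf infI; apply/eq_infty => r.
pose n := (Num.trunc (`|r| / c)).+1.
have [B BI nB] := infinite_set_fset n infI.
apply: (@le_trans _ _ (\sum_(k <- B) f k)%:E); last first.
  by apply: sum_le_esum; rewrite ?fset_uniq.
rewrite lee_fin; apply: (@le_trans _ _ (\sum_(k <- B) c)%R); last first.
  by rewrite big_seq [leRHS]big_seq; apply: ler_sum => k /BI; exact: cf.
rewrite big_const_seq count_predT iter_addr_0 (le_trans (ler_norm r)) //.
rewrite -mulr_natr -ler_pdivrMl // mulrC (le_trans (ltW (truncnS_gt _))) //.
by rewrite ler_nat.
Qed.


Lemma esum_tail_small (f : nat -> R) (e : R) : (forall k, (0 <= f k)%R) ->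
  \esum_(k in setT) (f k)%:E < +oo -> (0 < e)%R ->
  exists n, \esum_(k in [set k | (n <= k)%N]) (f k)%:E < e%:E.
Proof.
move=> f0 ffin e0; apply: contrapT => no.
have total0 : 0 <= \esum_(k in setT) (f k)%:E by apply: esum_ge0 => k _; rewrite lee_fin.
have tail n : e%:E <= \esum_(k in [set k | (n <= k)%N]) (f k)%:E.
  by rewrite leNgt; apply/negP => h; apply: no; exists n.
have split n : (\sum_(k < n) f k)%:E + \esum_(k in [set k | (n <= k)%N]) (f k)%:E <=
    \esum_(k in setT) (f k)%:E.
  rewrite [leRHS](@esumID _ _ [set k | (k < n)%N]) => [|k _]; last by rewrite lee_fin.
  apply: leeD.
    rewrite -(big_mkord xpredT f) /index_iota subn0; apply: sum_le_esum => //.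
      exact: iota_uniq.
    by move=> k; rewrite mem_iota add0n.
  apply: esum_subset => [k|k /= nk]; first by rewrite lee_fin.
  by split=> //; apply/negP; rewrite -leqNgt.
move: total0 ffin split; case E : (\esum_(k in setT) _) => [t| |] // _ _ split.
have : \esum_(k in setT) (f k)%:E <= (t - e)%:E.
  apply: esum_le_ord => // n; rewrite lee_fin lerBrDr -lee_fin EFinD.
  by apply: le_trans (split n); rewrite leeD2l.
by rewrite E lee_fin; lra.
Qed.

End Sums.

(** * Modulars and norms *)

Section Modular.
Context {R : realType}.
Local Open Scope ereal_scope.
Implicit Types (p r c : R) (x : R^nat) (T : R^nat -> R^nat).

(** The norm is a root of this sum, which splits over the coordinates. *)
Definition modular p x : \bar R := \esum_(k in [set: nat]) (gauge p (x k))%:E.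

(** The l^0 functional is the modular itself, not a root of it. *)
Definition mexp p : R := if p == 0%R then 1%R else p.

Lemma mexp_gt0 p : (0 <= p)%R -> (0 < mexp p)%R.
Proof. by move=> p0; rewrite /mexp; case: ifPn => // pN0; rewrite lt_neqAle eq_sym pN0. Qed.

Lemma modular_ge0 p x : 0 <= modular p x.
Proof. by apply: esum_ge0 => k _; rewrite lee_fin gauge_ge0. Qed.

Lemma lnormE p x : (0 <= p)%R -> lnorm p%:E x = modular p x `^ (mexp p)^-1.
Proof.
rewrite /lnorm /mexp eqe le_eqVlt => /predU1P[<-|p0].
  rewrite eqxx invr1 poweRe1 ?modular_ge0 // counting_dirac.
  rewrite nneseries_esumT // /modular; apply: eq_esum => k _.
  rewrite diracE /gauge; case: eqVneq => [xk|xk] /=.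
    by rewrite memNset //= => /negP; rewrite xk eqxx.
  by rewrite mem_set //= powRr0.
rewrite gt_eqF // Lnorm_counting //; congr (_ `^ _).
rewrite nneseries_esumT => [|k]; last exact: poweR_ge0.
by apply: eq_esum => k _; rewrite gaugeE.
Qed.

Lemma lnorm_ge0 (p : \bar R) x : 0 <= lnorm p x.
Proof. by rewrite /lnorm; case: ifP => _; [exact: measure_ge0|exact: Lnorm_ge0]. Qed.

Lemma modular_poweR p x : (0 <= p)%R -> modular p x = lnorm p%:E x `^ mexp p.
Proof.
move=> p0; rewrite lnormE // -poweRrM mulVf ?gt_eqF ?mexp_gt0 //.
by rewrite poweRe1 // modular_ge0.
Qed.

Lemma modular_le_of_lnorm p x c : (0 <= p)%R -> lnorm p%:E x <= c%:E ->
  modular p x <= (c `^ mexp p)%:E.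
Proof.
move=> p0 xc; rewrite modular_poweR // -poweR_EFin.
have c0 : 0 <= c%:E by apply: le_trans xc; exact: lnorm_ge0.
by rewrite gt0_ler_poweR ?(ltW (mexp_gt0 p0)) // in_itv /= ?lnorm_ge0 ?c0 leey.
Qed.

Lemma lnorm_le_of_modular p x c : (0 <= p)%R -> modular p x <= c%:E ->
  lnorm p%:E x <= (c `^ (mexp p)^-1)%:E.
Proof.
move=> p0 xc; rewrite lnormE // -poweR_EFin.
have c0 : 0 <= c%:E by apply: le_trans xc; exact: modular_ge0.
rewrite gt0_ler_poweR ?invr_ge0 ?(ltW (mexp_gt0 p0)) //.
  by rewrite in_itv /= modular_ge0 leey.
by rewrite in_itv /= c0 leey.
Qed.

Lemma lspace_modular p x : (0 <= p)%R -> lspace p%:E x <-> modular p x < +oo.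
Proof.
move=> p0; rewrite /lspace /=; split => h.
  by rewrite modular_poweR // poweR_lty.
by rewrite lnormE // poweR_lty.
Qed.

(** Singletons have positive counting measure, so the essential supremum is a
    supremum. *)
Lemma lnorm_oo_le x c : lnorm +oo x <= c%:E <-> (forall k, (`|x k| <= c)%R).
Proof.
rewrite /lnorm /= unlock; have ct0 k : 0 < @counting nat R [set k].
  by rewrite /counting asboolT // fset_set1 cardfs1 lte_fin.
rewrite ifT; last first.
  by apply: lt_le_trans (ct0 0%N) _; apply: le_measure; rewrite ?inE.
split => [/ess_sup_inf.ess_supP [N [mN N0 xN]] k|xc]; last first.
  by apply/ess_sup_inf.ess_supP/nearW => k /=; rewrite lee_fin.
rewrite leNgt; apply/negP => kc.
have kN : N k by apply: xN => /=; rewrite lee_fin => /le_lt_trans/(_ kc); rewrite ltxx.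
have := @le_measure _ R _ (@counting nat R) [set k] N.
rewrite !inE => /(_ I I) kN0; have := ct0 k; rewrite ltNge => /negP; apply.
by apply: le_trans (kN0 _) _ => [_ ->|]; [exact: kN|move/eqP: N0; rewrite eq_le => /andP[]].
Qed.

Lemma lspace_fin (p : \bar R) x : lspace p x <-> exists c, lnorm p x <= c%:E.
Proof.
rewrite /lspace /=; split => [h|[c /le_lt_trans]]; last by apply; rewrite ltry.
by exists (fine (lnorm p x)); rewrite fineK // ge0_fin_numE ?lnorm_ge0.
Qed.

Lemma gauge_le_modular p x k : (gauge p (x k))%:E <= modular p x.
Proof.
have := @sum_le_esum R nat setT (fun k => gauge p (x k)) [:: k].
by rewrite big_seq1; apply => // j; exact: gauge_ge0.
Qed.

Lemma lnorm_eq0 (p : \bar R) x : 0 <= p -> lnorm p x = 0 -> x = 0%R.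
Proof.
case: p => [p| |] // p0 x0; apply/funext => k; apply/eqP.
  have m0 : modular p x = 0.
    by rewrite modular_poweR // x0 poweR0r // gt_eqF // mexp_gt0.
  have := gauge_le_modular p x k.
  by rewrite m0 lee_fin -[_ == _](gauge_eq0 p) eq_le gauge_ge0 andbT.
have /lnorm_oo_le/(_ k) : lnorm +oo x <= 0%:E by rewrite x0.
by rewrite normr_le0.
Qed.

Lemma modular0 p : modular p 0%R = 0.
Proof. by apply: esum1 => k _; rewrite gauge0. Qed.

Lemma lnorm0 (p : \bar R) : 0 <= p -> lnorm p 0%R = 0.
Proof.
case: p => [p| |] // p0.
  by rewrite lnormE // modular0 poweR0r // invr_eq0 gt_eqF // mexp_gt0.
by apply/eqP; rewrite eq_le lnorm_ge0 andbT; apply/lnorm_oo_le => k; rewrite normr0.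
Qed.

Lemma lnorm_gt0 (p : \bar R) x : 0 <= p -> x <> 0%R -> 0 < lnorm p x.
Proof.
move=> p0 x0; rewrite lt_neqAle lnorm_ge0 andbT eq_sym.
by apply/eqP => /(lnorm_eq0 p0).
Qed.

Lemma bounded_on_of_le (p : \bar R) T c : 0 <= p ->
  (forall x, lspace p x -> lnorm p (T x) <= c%:E * lnorm p x) ->
  bounded_on p T /\ opnorm p T <= c%:E.
Proof.
move=> p0 h; have opc : opnorm p T <= c%:E.
  apply: ge_ereal_sup => _ [x [xp xN0] <-].
  have := h _ xp; have n0 := lnorm_gt0 p0 xN0; move: xp n0; rewrite /lspace /=.
  by case: (lnorm p x) => // r _ r0; rewrite inver gt_eqF // lee_pdivrMr.
split=> //; split; last by apply: le_lt_trans opc _; rewrite ltry.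
move=> x xp; apply: le_lt_trans (h _ xp) _.
move: xp; rewrite /lspace /=; have := lnorm_ge0 p x.
by case: (lnorm p x) => // r _ _; rewrite ltry.
Qed.

Lemma lnorm_le_opnorm (p : \bar R) T c : 0 <= p -> T 0%R = 0%R -> (0 <= c)%R ->
  opnorm p T <= c%:E -> forall x, lspace p x -> lnorm p (T x) <= c%:E * lnorm p x.
Proof.
move=> p0 T0 c0 opT x xp; have [->|xN0] := pselect (x = 0%R).
  by rewrite T0 lnorm0 // mule0.
have n0 := lnorm_gt0 p0 xN0.
have : lnorm p (T x) / lnorm p x <= c%:E.
  by apply: le_trans opT; apply: ereal_sup_ubound; exists x.
move: (xp) n0; rewrite /lspace /=; case: (lnorm p x) => // r _ r0.
by rewrite inver gt_eqF // lee_pdivrMr.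
Qed.

Lemma bounded_on_le (p : \bar R) T : 0 <= p -> T 0%R = 0%R -> bounded_on p T ->
  exists2 c, (0 <= c)%R & forall x, lspace p x -> lnorm p (T x) <= c%:E * lnorm p x.
Proof.
move=> p0 T0 [Tp opT]; exists (Num.max 0 (fine (opnorm p T)))%R.
  by rewrite le_max lexx.
apply: lnorm_le_opnorm => //; first by rewrite le_max lexx.
move: opT; case: (opnorm p T) => [s _| |_] //; last by rewrite leNye.
by rewrite lee_fin le_max lexx orbT.
Qed.

Lemma lnorm_le_scale p c x y : (0 <= p)%R -> (0 <= c)%R ->
  modular p x <= c%:E * modular p y ->
  lnorm p%:E x <= (c `^ (mexp p)^-1)%:E * lnorm p%:E y.
Proof.
move=> p0 c0 h; rewrite !lnormE // -poweR_EFin -poweRM ?modular_ge0 //.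
rewrite gt0_ler_poweR ?invr_ge0 ?(ltW (mexp_gt0 p0)) //.
  by rewrite in_itv /= modular_ge0 leey.
by rewrite in_itv /= leey andbT mule_ge0 ?modular_ge0.
Qed.

Lemma modular_le_scale p c x y : (0 <= p)%R -> (0 <= c)%R ->
  lnorm p%:E x <= c%:E * lnorm p%:E y ->
  modular p x <= (c `^ mexp p)%:E * modular p y.
Proof.
move=> p0 c0 h; rewrite !modular_poweR // -poweR_EFin -poweRM ?lnorm_ge0 //.
rewrite gt0_ler_poweR ?(ltW (mexp_gt0 p0)) //.
  by rewrite in_itv /= lnorm_ge0 leey.
by rewrite in_itv /= leey andbT mule_ge0 ?lnorm_ge0.
Qed.

End Modular.

(** * Matching large and small entries *)

Section Selection.

(** Dependent choice where each step depends on all the previous ones. *)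
Lemma history_choice (T : Type) (P : seq T -> T -> Prop) :
  (forall s, exists a, P s a) -> exists f : nat -> T, forall n, P (mkseq f n) (f n).
Proof.
move=> /choice[g gP].
pose h := fix h n := if n is m.+1 then rcons (h m) (g (h m)) else [::].
have hE n : h n = mkseq (g \o h) n.
  by elim: n => // n IH; rewrite mkseqS /= {1}IH.
by exists (g \o h) => n; rewrite -hE; exact: gP.
Qed.

Lemma infinite_notin (A : set nat) (s : seq nat) :
  infinite_set A -> exists2 k, A k & k \notin s.
Proof.
move=> infA; have := infinite_setN0 (infinite_setD infA (finite_seq s)).
by move=> [k [Ak ks]]; exists k => //; apply/negP.
Qed.

Context {R : realType}.

Lemma seq_argmax (T : eqType) (f : T -> R) (s : seq T) : s != [::] ->
  exists2 a, a \in s & forall b, b \in s -> f b <= f a.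
Proof.
elim: s => // a s IH _; have [->|/IH[b bs bmax]] := eqVneq s [::].
  by exists a; rewrite ?mem_seq1 // => b; rewrite mem_seq1 => /eqP ->.
case: (leP (f a) (f b)) => [ab|/ltW ba].
  by exists b; rewrite ?inE ?bs ?orbT // => c; rewrite inE => /predU1P[->|/bmax].
exists a; rewrite ?inE ?eqxx // => c; rewrite inE => /predU1P[->//|/bmax].
by move/le_trans; apply.
Qed.

(** A largest value among those not yet listed always exists, because only
    finitely many values exceed a given positive one. The values may nevertheless
    accumulate, from above, at a positive level. *)
Lemma decreasing_enumeration (f : nat -> R) : (forall k, 0 <= f k) ->
  (forall i, 0 < f i -> finite_set [set k | f i <= f k]) ->
  exists s : nat -> nat, [/\ injective s,
    forall m n, (m <= n)%N -> f (s n) <= f (s m) &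
    forall k, 0 < f k -> exists n, s n = k].
Proof.
move=> f0 ffin.
have [t|s sP] := @history_choice nat
    (fun t a => a \notin t /\ forall i, i \notin t -> f i <= f a).
  have [[i [it fi0]]|no] := pselect (exists i, i \notin t /\ 0 < f i).
    have /finite_seqP[r rE] := ffin _ fi0.
    have [] := @seq_argmax _ f [seq k <- r | k \notin t].
      apply/eqP => r0; have : i \in [seq k <- r | k \notin t].
        rewrite mem_filter it /=; have : [set k | f i <= f k] i by exact: lexx.
        by rewrite rE.
      by rewrite r0.
    move=> a; rewrite mem_filter => /andP[at_ ar] amax; exists a; split=> // k kt.
    have fia : f i <= f a.
      by have : [set` r] a by []; rewrite -rE.
    have [fki|/ltW fik] := leP (f k) (f i); first exact: le_trans fia.
    apply: amax; rewrite mem_filter kt.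
    have : [set k | f i <= f k] k by [].
    by rewrite rE.
  have [k _ kt] := @infinite_notin setT t infinite_nat.
  exists k; split=> // i it; apply: le_trans (f0 k).
  by rewrite leNgt; apply/negP => fi0; apply: no; exists i.
have snew n i : (i < n)%N -> s n != s i.
  have [+ _] := sP n => + ilt; apply: contraNneq => ->.
  by apply/mapP; exists i; rewrite ?mem_iota.
have sinj : injective s.
  move=> m n; case: (ltngtP m n) => // [mn|mn] e.
    by have := snew _ _ mn; rewrite e eqxx.
  by have := snew _ _ mn; rewrite e eqxx.
exists s; split=> // [m n mn|k fk0].
  have [_] := sP m; apply; apply/mapP => -[i]; rewrite mem_iota add0n => im.
  by apply/eqP/snew; exact: leq_trans mn.
apply: contrapT => nk; have kle n : f k <= f (s n).
  have [_] := sP n; apply; apply/mapP => -[i _ e]; apply: nk; by exists i.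
apply: infinite_nat; apply: sub_finite_set (finite_preimage _ (ffin _ fk0)).
  by move=> n _; exact: kle.
by move=> m n _ _; exact: sinj.
Qed.

Lemma esum_mkcond_real (I : set nat) (P : pred nat) (f : nat -> R) :
  (forall n, I n <-> P n) ->
  (\esum_(n in I) (f n)%:E = \esum_(n in setT) (if P n then f n else 0)%:E)%E.
Proof.
move=> IP; rewrite esum_mkcond; apply: eq_esum => n _.
have [Pn|Pn] := boolP (P n); first by rewrite mem_set //; apply/IP.
by rewrite memNset // => /IP; rewrite (negbTE Pn).
Qed.

(** Greedy assignment of the masses [Y n], taken in their order, to bins [k] of
    capacity [C * X k]: when every bin admissible for [n] is full, the masses
    placed before [n] already exhaust the total capacity of these bins. The last
    mass placed in a bin may overflow it, by at most [X k]. *)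
Lemma greedy_assignment (X Y : nat -> R) (A : nat -> set nat) (C : R) :
  0 <= C -> (forall k, 0 <= X k) -> (forall n, 0 <= Y n) ->
  (forall n k, A n k -> Y n <= X k) ->
  (forall n, 0 < Y n ->
    ((\sum_(i < n.+1) Y i)%:E <= C%:E * \esum_(k in A n) (X k)%:E)%E) ->
  exists kappa : nat -> nat, (forall n, 0 < Y n -> A n (kappa n)) /\
    forall k, (\esum_(n in [set n | kappa n = k]) (Y n)%:E <= ((C + 1) * X k)%:E)%E.
Proof.
move=> C0 X0 Y0 YX dom.
have [s|kappa kP] := @history_choice nat (fun s k => 0 < Y (size s) ->
    A (size s) k /\ \sum_(i < size s | nth 0%N s i == k) Y i < C * X k).
  set n := size s; have [Yn0|/negP nY] := boolP (0 < Y n); last by exists 0%N.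
  apply: contrapT => no; have := dom n Yn0; apply/negP; rewrite -ltNge.
  apply: (@le_lt_trans _ _ (\sum_(i < n) Y i)%:E); last first.
    by rewrite lte_fin big_ord_recr /= ltrDl.
  rewrite -esumZl //.
  under eq_esum do rewrite -EFinM; apply: esum_le_fin => t ut tA.
  rewrite lee_fin; apply: (@le_trans _ _
      (\sum_(k <- t) \sum_(i < n | nth 0%N s i == k) Y i)).
    rewrite big_seq [leRHS]big_seq; apply: ler_sum => k kt.
    by rewrite leNgt; apply/negP => lt; apply: no; exists k => _; split=> //; exact: tA.
  rewrite (exchange_big_dep xpredT) //=; apply: ler_sum => i _.
  have [it|it] := boolP (nth 0%N s i \in t); last first.
    by rewrite big_seq_cond big_pred0 // => k; apply/andP => -[kt /eqP e]; rewrite e kt in it.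
  rewrite (eq_bigl (pred1 (nth 0%N s i))) => [|k]; last by rewrite eq_sym.
  by rewrite -big_filter filter_pred1_uniq // big_seq1.
exists kappa; split=> [n Yn0|k]; first by have := kP n; rewrite size_mkseq => /(_ Yn0)[].
rewrite (@esum_mkcond_real _ (fun n => kappa n == k)); last by move=> n; split=> /eqP.
apply: esum_le_ord => [n|n]; first by case: ifP.
rewrite lee_fin; elim: n => [|n IH].
  by rewrite big_ord0 mulr_ge0 // addr_ge0.
rewrite big_ord_recr /=; case: eqP => [kn|_]; last by rewrite addr0.
have := Y0 n; rewrite le_eqVlt => /predU1P[<-|Yn0]; first by rewrite addr0.
have := kP n; rewrite size_mkseq => /(_ Yn0)[/YX].
rewrite kn => YXk.
rewrite (_ : \sum_(i < n | _) Y i = \sum_(i < n | kappa i == k) Y i); last first.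
  by apply: eq_bigl => i; rewrite nth_mkseq.
by rewrite big_mkcond /= mulrDl mul1r => /ltW h; exact: lerD.
Qed.


(** The entries [y j] with finitely many larger ones are placed greedily, in
    decreasing order, among the entries of [x]. Every other [y j] sees an infinite
    sum of masses above it, so it lies below infinitely many entries of [x], and
    these can be used once each. *)
Lemma head_matching (p : R) (x y : nat -> R) (J : set nat) (C : R) :
  0 <= p -> 0 <= C -> (forall j, J j -> y j != 0) ->
  (forall j, J j ->
    (\esum_(i in J `&` [set i | (`|y j| <= `|y i|)%R]) (gauge p (y i))%:E <=
     C%:E * \esum_(k in [set k | (`|y j| <= `|x k|)%R]) (gauge p (x k))%:E)%E) ->
  exists kappa : nat -> nat, (forall j, J j -> `|y j| <= `|x (kappa j)|) /\
    forall k, (\esum_(j in J `&` [set j | kappa j = k]) (gauge p (y j))%:E <=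
       ((C + 2) * gauge p (x k))%:E)%E.
Proof.
move=> p0 C0 y0 dom.
have g0 z k : 0 <= gauge p (z k) :> R by exact: gauge_ge0.
pose J1 := J `&` [set j | finite_set (J `&` [set i | `|y j| <= `|y i|])].
pose f (j : nat) : R := if j \in J1 then `|y j| else 0.
have f0 k : 0 <= f k by rewrite /f; case: ifP.
have fgt j : 0 < f j -> J1 j /\ f j = `|y j|.
  by rewrite /f; case: ifPn => [|_]; [rewrite inE|rewrite ltxx].
have [s [sinj smono ssurj]] : exists s : nat -> nat, [/\ injective s,
    forall m n, (m <= n)%N -> f (s n) <= f (s m) &
    forall k, 0 < f k -> exists n, s n = k].
  apply: decreasing_enumeration => // i fi0; have [[Ji fini] fE] := fgt _ fi0.
  apply: sub_finite_set fini => k /= fik.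
  have [[Jk _] fkE] := fgt _ (lt_le_trans fi0 fik).
  by split; rewrite //= -fE -fkE.
pose Y n := if s n \in J1 then gauge p (y (s n)) else 0.
have Y0 n : 0 <= Y n by rewrite /Y; case: ifP => // _; exact: gauge_ge0.
have YJ n : 0 < Y n -> J1 (s n).
  by rewrite /Y; case: ifPn => [|_]; [rewrite inE|rewrite ltxx].
have [k1 [k1A k1load]] : exists kappa : nat -> nat,
    (forall n, 0 < Y n -> `|y (s n)| <= `|x (kappa n)|) /\
    forall k, (\esum_(n in [set n | kappa n = k]) (Y n)%:E <=
       ((C + 1) * gauge p (x k))%:E)%E.
  apply: (@greedy_assignment (fun k => gauge p (x k)) Y
    (fun n => [set k | `|y (s n)| <= `|x k|])) => // [n k /= yx|n Yn0].
    by rewrite /Y; case: ifP => _; rewrite ?gauge_ge0 ?ler_gauge.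
  have Jn := YJ _ Yn0; apply: le_trans (dom _ Jn.1).
  have [m mE] : exists m, m = n.+1 by exists n.+1.
  rewrite -mE -(big_mkord xpredT Y) /index_iota subn0.
  rewrite (bigID (fun i => s i \in J1)) /= addrC big1 => [|i /negbTE iJ]; last by rewrite /Y iJ.
  rewrite add0r -big_filter (eq_big_seq (fun i => gauge p (y (s i)))); last first.
    by move=> i; rewrite mem_filter /Y => /andP[-> _].
  rewrite -(big_map s xpredT (fun j => gauge p (y j))); apply: sum_le_esum => //.
    by rewrite map_inj_uniq // filter_uniq // iota_uniq.
  move=> j /mapP[i]; rewrite mem_filter mem_iota add0n => /andP[/set_mem iJ1 /=].
  rewrite mE ltnS => il ->.
  split; first by case: iJ1.
  by have := smono _ _ il; rewrite /f !mem_set.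
pose big_ j := infinite_set (J `&` [set i | `|y j| <= `|y i|]).
have [k2 k2inj k2A] : exists2 kappa : nat -> nat, injective kappa &
    forall j, J j -> big_ j -> `|y j| <= `|x (kappa j)|.
  have [t|k2 k2P] := @history_choice nat (fun t k => k \notin t /\
      (J (size t) -> big_ (size t) -> `|y (size t)| <= `|x k|)).
    have [[Jt inft]|no] := pselect (J (size t) /\ big_ (size t)); last first.
      have [k _ kt] := @infinite_notin setT t infinite_nat.
      by exists k; split=> // ? ?; case: no.
    have infx : infinite_set [set k | `|y (size t)| <= `|x k|].
      move=> finx; have := dom _ Jt.
      rewrite (@esum_ge_infinite _ _ _ _ (gauge p (y (size t)))) //.
      - have := @esum_lty _ _ _ (fun k => gauge p (x k)) (fun k => gauge_ge0 _ _) finx.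
        have : (0 <= \esum_(k in [set k | (`|y (size t)| <= `|x k|)%R]) (gauge p (x k))%:E)%E.
          by apply: esum_ge0 => k _; rewrite lee_fin.
        by case: (\esum_(k in _) _)%E => // r _ _; rewrite -EFinM leye_eq.
      - by apply: gauge_gt0; exact: y0.
      - by move=> i [_ /= yi]; exact: ler_gauge.
    by have [k kx kt] := infinite_notin t infx; exists k.
  exists k2 => [m n|j Jj bj]; last first.
    by have := k2P j; rewrite size_mkseq => -[_ /(_ Jj bj)].
  have k2new i m' : (i < m')%N -> k2 m' != k2 i.
    have [+ _] := k2P m' => + ilt; apply: contraNneq => ->.
    by apply/mapP; exists i; rewrite ?mem_iota.
  case: (ltngtP m n) => // [mn|mn] e.
    by have := k2new _ _ mn; rewrite e eqxx.
  by have := k2new _ _ mn; rewrite e eqxx.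
have /choice[r rP] j : exists r, J1 j -> s r = j.
  have [J1j|nJ1] := pselect (J1 j); last by exists 0%N.
  have [|n sn] := ssurj j; last by exists n.
  by rewrite /f mem_set // normr_gt0 y0 //; case: J1j.
exists (fun j => if j \in J1 then k1 (r j) else k2 j); split.
  move=> j Jj; case: ifPn => [|/negP jJ1].
    rewrite inE => jJ1; rewrite -{1}(rP _ jJ1); apply: k1A.
    by rewrite /Y rP // mem_set // gauge_gt0 // y0.
  apply: k2A => // finj; apply: jJ1; rewrite inE; split=> //.
move=> k; rewrite (@esumID _ _ J1) => [|i _]; last by rewrite lee_fin.
have -> : C + 2 = (C + 1) + 1 by rewrite -addrA.
rewrite mulrDl mul1r EFinD; apply: leeD.
  apply: le_trans (k1load k).
  apply: (@le_trans _ _ (\esum_(j in s @` [set n | k1 n = k]) (if j \in J1 then gauge p (y j) else 0)%:E)%E).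
    rewrite esum_mkcond [leRHS]esum_mkcond; apply: le_esum => j _.
    case: ifPn => [|_]; last by case: ifP => // _; rewrite lee_fin; case: ifP.
    rewrite inE => -[[Jj /= kj] J1j]; rewrite mem_set in kj => //.
    rewrite !mem_set //; exists (r j) => //=; exact: rP.
  by rewrite esum_image // => m n _ _; exact: sinj.
rewrite -[leRHS](esum_set1 (a := fun k => (gauge p (x k))%:E)) ?lee_fin //.
set I := J `&` _ `&` _.
apply: (@le_trans _ _ (\esum_(j in I) (gauge p (x (k2 j)))%:E)%E).
  apply: le_esum => j [[Jj /= kj] nJ1]; rewrite lee_fin ler_gauge //.
  by apply: k2A => // finj; apply: nJ1.
rewrite -(esum_image I k2 (fun k => (gauge p (x k))%:E)) => [|m n _ _]; last exact: k2inj.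
apply: esum_subset => // [j|_ [j [[Jj /= kj] nJ1] <-]]; first by rewrite lee_fin.
by rewrite memNset in kj.
Qed.

(** The tails [T n] of the decreasing summable sequence [X] sweep down to 0, and
    disjoint intervals of length [2 * Y j] are stacked upwards from 0 in increasing
    order of [Y j]. The index [n] is given to [j] when [T n.+1] falls in the [j]-th
    interval; the steps [X n] made there are at most [Y j], so they add up to at
    least half the length of the interval. *)
Lemma tail_matching (X Y : nat -> R) (J : set nat) :
  (forall n, 0 <= X n) -> (forall m n, (m <= n)%N -> X n <= X m) ->
  (\esum_(n in setT) (X n)%:E < +oo)%E -> (forall j, J j -> 0 < Y j) ->
  (forall j, J j ->
    (2%:E * (\esum_(i in J `&` [set i | (Y i <= Y j)%R]) (Y i)%:E) <=
     \esum_(n in [set n | (X n <= Y j)%R]) (X n)%:E)%E) ->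
  exists a b : nat -> nat, [/\
    forall j n, J j -> (a j <= n < b j)%N -> X n <= Y j,
    forall j, J j -> Y j <= \sum_(a j <= n < b j) X n &
    forall i j n, J i -> J j -> (a i <= n < b i)%N -> (a j <= n < b j)%N -> i = j].
Proof.
move=> X0 Xmono Xfin Y0 dom.
pose Z j := if j \in J then Y j else 0.
have Z0 j : 0 <= Z j by rewrite /Z; case: ifPn => // /set_mem/Y0/ltW.
have ZJ j : J j -> Z j = Y j by move=> Jj; rewrite /Z mem_set.
pose T n := fine (\esum_(m in [set m | (n <= m)%N]) (X m)%:E).
have TE n : (\esum_(m in [set m | (n <= m)%N]) (X m)%:E = (T n)%:E)%E.
  rewrite /T fineK // ge0_fin_numE; last by apply: esum_ge0 => m _; rewrite lee_fin.
  by apply: le_lt_trans Xfin; apply: esum_subset => // m; rewrite lee_fin.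
have T0 n : 0 <= T n by rewrite -lee_fin -TE; apply: esum_ge0 => m _; rewrite lee_fin.
have TS n : T n = X n + T n.+1.
  apply: EFin_inj; rewrite EFinD -!TE (@esumID _ _ [set n]); last first.
    by move=> m _; rewrite lee_fin.
  congr (_ + _)%E.
    rewrite (_ : _ `&` _ = [set n]) ?esum_set1 ?lee_fin //.
    by apply/seteqP; split=> [m [_ ->]|m /= ->].
  congr (esum _ _); apply/seteqP; split=> m /=.
    by move=> [nm /eqP mn]; rewrite ltn_neqAle eq_sym mn.
  by move=> nm; split; [exact: ltnW|move=> mn; rewrite mn ltnn in nm].
have Tmono m n : (m <= n)%N -> T n <= T m.
  move=> /subnK <-; elim: (n - m)%N => // k IH; apply: le_trans IH.
  by rewrite addSn (TS (k + m)%N) lerDr.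
have Tsum a b : (a <= b)%N -> \sum_(a <= n < b) X n = T a - T b.
  move=> ab; rewrite (eq_bigr (fun n => - T n.+1 - - T n)) => [|n _].
    by rewrite telescope_sumr // opprK addrC.
  by rewrite (TS n) opprK addrC addrK.
have Tsmall (e : R) : 0 < e -> exists n, T n < e.
  by move=> e0; have [n] := esum_tail_small X0 Xfin e0; rewrite TE lte_fin; exists n.
have Xsmall (e : R) : 0 < e -> exists n, X n <= e.
  by move=> /Tsmall[n Tn]; exists n; apply: le_trans (ltW Tn); rewrite (TS n) lerDl.
pose before j := [set i | J i /\ (Y i < Y j \/ Y i = Y j /\ (i < j)%N)].
pose W j : \bar R := (\esum_(i in before j) (Z i)%:E)%E.
have dom' j : J j -> forall n, (forall m, X m <= Y j -> (n <= m)%N) ->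
    (2%:E * (W j + (Y j)%:E) <= (T n)%:E)%E.
  move=> Jj n nP; apply: (@le_trans _ _ (\esum_(m in [set m | (X m <= Y j)%R]) (X m)%:E)%E).
    apply: le_trans (dom _ Jj); rewrite lee_pmul2l // (@esumID _ _ (before j)); last first.
      by move=> i [/Y0/ltW ?]; rewrite lee_fin.
    apply: leeD.
      rewrite /W [leRHS](eq_esum (b := fun i => (Z i)%:E)); last by move=> i [[Ji _] _]; rewrite ZJ.
      apply: esum_subset => [i|i [Ji h]]; first by rewrite lee_fin.
      by split=> //; split=> //=; case: h => [/ltW|[->]].
    rewrite -[leLHS](esum_set1 (a := fun i => (Y i)%:E)); last by rewrite lee_fin ltW ?Y0.
    rewrite [leLHS](_ : _ = \esum_(i in [set j]) (Z i)%:E)%E; last first.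
      by apply: eq_esum => i ->; rewrite ZJ.
    rewrite [leRHS](_ : _ =
        \esum_(i in J `&` [set i | (Y i <= Y j)%R] `&` ~` before j) (Z i)%:E)%E; last first.
      by apply: eq_esum => i [[Ji _] _]; rewrite ZJ.
    apply: esum_subset => [i|i -> /=]; first by rewrite lee_fin.
    by split; [split=> /=|case=> _ []; rewrite ?ltxx // ltnn => -[]].
  by rewrite -TE; apply: esum_subset => [m|m /= /nP]; rewrite ?lee_fin.
have W0 j : (0 <= W j)%E by apply: esum_ge0 => i _; rewrite lee_fin.
pose w j := fine (W j).
have WE j : J j -> W j = (w j)%:E.
  move=> Jj; rewrite /w fineK // ge0_fin_numE //.
  have := dom' _ Jj 0%N (fun m _ => leq0n m); case: (W j) (W0 j) => [r| |] //=.
    by rewrite ltry.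
  by rewrite addye // mulry gtr0_sg // mul1e.
have {}dom j n : J j -> (forall m, X m <= Y j -> (n <= m)%N) ->
    2 * (w j + Y j) <= T n.
  by move=> Jj nP; have := dom' _ Jj _ nP; rewrite (WE _ Jj) -EFinD -EFinM lee_fin.
have w0 j : 0 <= w j by exact: fine_ge0.
have wS i j : J i -> J j -> before j i -> w i + Y i <= w j.
  move=> Ji Jj ij; rewrite -lee_fin EFinD -!WE // [leRHS](@esumID _ _ (before i)); last first.
    by move=> k _; rewrite lee_fin.
  case: ij => _ ij; apply: leeD.
    apply: esum_subset => [k|k [Jk ki]]; first by rewrite lee_fin.
    split; split=> //; case: ki => [ki|[ki ki']]; case: ij => [ij|[ij ij']].
    - by left; apply: lt_trans ij.
    - by left; rewrite -ij.
    - by left; rewrite ki.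
    - by right; rewrite ki; split=> //; exact: ltn_trans ij'.
  rewrite -(ZJ _ Ji) -[leLHS](esum_set1 (a := fun i => (Z i)%:E)); last by rewrite lee_fin.
  apply: esum_subset => [k|k -> /=]; first by rewrite lee_fin.
  by split=> //; case=> _ []; rewrite ?ltxx // ltnn => -[].
(* [a j] is the first index at which the remaining tail has dropped below the top
   of the [j]-th interval; by domination the terms are at most [Y j] from there *)
have aP j : exists a, J j -> [/\ T a.+1 < 2 * (w j + Y j), 2 * (w j + Y j) <= T a &
    forall n, (a <= n)%N -> X n <= Y j].
  have [Jj|nJ] := pselect (J j); last by exists 0%N.
  have Yj0 := Y0 _ Jj; have wY0 : 0 < 2 * (w j + Y j) by have := w0 j; lra.
  have exa : exists n, T n.+1 < 2 * (w j + Y j).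
    have [n Tn] := Tsmall _ wY0; exists n; apply: le_lt_trans Tn; exact: Tmono.
  have [n0 n0Y n0min] := ex_minnP (Xsmall _ Yj0).
  have n0T := dom _ _ Jj n0min.
  have [a aT amin] := ex_minnP exa; exists a => _.
  have n0a : (n0 <= a)%N.
    by rewrite leqNgt; apply/negP => /Tmono /(le_trans n0T); rewrite leNgt aT.
  split=> // [|n an]; last by apply: le_trans n0Y; apply: Xmono; exact: leq_trans an.
  move: n0a; rewrite leq_eqVlt => /predU1P[<-//|]; case: a aT amin => // a _ amin _.
  by rewrite leNgt; apply/negP => /amin; rewrite ltnn.
have [a {}aP] := @choice _ _ (fun j a => _) aP.
(* [b j] is the first index at which [Y j] has been collected; the last step is
   at most [Y j], so the tail has not yet left the interval from below *)
have bP j : exists b, J j -> T b <= T (a j) - Y j /\ forall n, (n < b)%N -> T (a j) - Y j < T n.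
  have [Jj|nJ] := pselect (J j); last by exists 0%N.
  have [_ aT _] := aP _ Jj; have Yj0 := Y0 _ Jj; have wj0 := w0 j.
  have [|n Tn] := Tsmall (T (a j) - Y j); first by lra.
  have [b bT bmin] := ex_minnP (ex_intro (fun n => T n <= T (a j) - Y j) n (ltW Tn)).
  exists b => _; split=> // m mb; rewrite ltNge; apply/negP => /bmin.
  by rewrite leqNgt mb.
have [b {}bP] := @choice _ _ (fun j b => _) bP.
have abJ j n : J j -> (a j <= n < b j)%N -> 2 * w j <= T n.+1 < 2 * (w j + Y j).
  move=> Jj /andP[an nb]; have [aT aT' aX] := aP _ Jj; have [_ bT] := bP _ Jj.
  have Yj0 := Y0 _ Jj; have := Tmono (a j).+1 n.+1 an; have := bT _ nb.
  by have := aX _ an; have := TS n; move=> *; apply/andP; split; lra.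
have disj i j n : J i -> J j -> before j i ->
    (a i <= n < b i)%N -> (a j <= n < b j)%N -> False.
  move=> Ji Jj /wS-/(_ Ji Jj) ij /(abJ _ _ Ji)/andP[_ h1] /(abJ _ _ Jj)/andP[h2 _].
  suff : T n.+1 < T n.+1 by rewrite ltxx.
  by apply: lt_le_trans h1 (le_trans _ h2); rewrite ler_pM2l.
exists a, b; split.
- by move=> j n Jj /andP[an _]; have [_ _] := aP _ Jj; apply.
- move=> j Jj; have Yj0 := Y0 _ Jj; have [bT _] := bP _ Jj.
  rewrite Tsum; first lra.
  rewrite leqNgt; apply/negP => /ltnW/Tmono h; suff : Y j <= 0 by rewrite leNgt Yj0.
  lra.
- move=> i j n Ji Jj ni nj; have d1 := disj i j n Ji Jj; have d2 := disj j i n Jj Ji.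
  case: (ltgtP (Y i) (Y j)) => [ij|ji|e].
  + by case: d1 => //; split=> //; left.
  + by case: d2 => //; split=> //; left.
  + case: (ltngtP i j) => // ij.
      by case: d1 => //; split=> //; right.
    by case: d2 => //; split=> //; right.
Qed.

End Selection.

(** * Operators built from matchings *)

Section Operators.
Context {R : realType}.
Implicit Types (p q r : R) (x y u : nat -> R) (J : set nat).

Definition linear_map (T : R^nat -> R^nat) :=
  forall (a : R) u v, T (a *: u + v) = a *: T u + T v.

Definition head_operator x y J (kappa : nat -> nat) (u : R^nat) : R^nat :=
  fun j => if j \in J then y j / x (kappa j) * u (kappa j) else 0.

Lemma head_operator_linear x y J kappa : linear_map (head_operator x y J kappa).
Proof.
move=> c u v; apply/funext => j; rewrite /head_operator /= !fctE /=.
case: ifP => _; last by rewrite scaler0 addr0.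
by rewrite /GRing.scale /= mulrDr mulrCA.
Qed.

(** The entries [y j / x (kappa j)] are at most 1, so their [r]-th powers are
    largest for [r = p], where the matching bounds the sum of a column. *)
Lemma head_operator_modular p r x y J kappa (C : R) u : 0 <= p -> p <= r -> 0 <= C ->
  (forall j, J j -> y j != 0 /\ `|y j| <= `|x (kappa j)|) ->
  (forall k, (\esum_(j in J `&` [set j | kappa j = k]) (gauge p (y j))%:E <=
       (C * gauge p (x k))%:E)%E) ->
  (modular r (head_operator x y J kappa u) <= C%:E * modular r u)%E.
Proof.
move=> p0 pr C0 Jy load.
pose F j := gauge p (y j / x (kappa j)) * gauge r (u (kappa j)).
have F0 j : 0 <= F j by rewrite mulr_ge0 ?gauge_ge0.
apply: (@le_trans _ _ (\esum_(j in J) (F j)%:E)%E).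
  rewrite [leRHS]esum_mkcond; apply: le_esum => j _; rewrite /head_operator.
  case: ifPn => [/set_mem Jj|_]; last by rewrite gauge0.
  have [yj0 yx] := Jy _ Jj; rewrite lee_fin gaugeM ler_wpM2r ?gauge_ge0 //.
  apply: ler_gauge_exp => //; rewrite normrM normfV ler_pdivrMr ?mul1r //.
  by apply: lt_le_trans yx; rewrite normr_gt0.
have -> : J = \bigcup_(k in setT) (J `&` [set j | kappa j = k]).
  by apply/seteqP; split=> [j Jj|j [k _ []] //]; exists (kappa j).
rewrite esum_bigcupT; last 2 first.
- by move=> k k' _ _ [j [[_ /= ->] [_ /= ->]]].
- by move=> j; rewrite lee_fin.
rewrite -esumZl // => [|k]; last by rewrite lee_fin gauge_ge0.
apply: le_esum => k _.
have [[j [Jj /= kj]]|no] := pselect (exists j, J j /\ kappa j = k); last first.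
  rewrite esum1 ?mule_ge0 ?lee_fin ?gauge_ge0 // => j [Jj /= kj].
  by case: no; exists j.
have xk0 : x k != 0.
  have [yj0 yx] := Jy _ Jj; rewrite -normr_gt0 -kj.
  by apply: lt_le_trans yx; rewrite normr_gt0.
have gx0 := gauge_gt0 p xk0.
rewrite (eq_esum (b := fun j => ((gauge p (x k))^-1 * gauge r (u k))%:E * (gauge p (y j))%:E)%E).
  rewrite esumZl => [|//|i]; last by rewrite lee_fin gauge_ge0.
    apply: le_trans (lee_wpmul2l _ (load k)) _.
      by rewrite lee_fin mulr_ge0 ?invr_ge0 ?gauge_ge0.
    rewrite -!EFinM lee_fin le_eqVlt; apply/orP; left; apply/eqP.
    by field; rewrite gt_eqF.
  by rewrite mulr_ge0 ?invr_ge0 ?gauge_ge0.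
move=> i [Ji /= <-]; rewrite -EFinM; congr (_%:E); rewrite /F.
have -> : gauge p (y i / x (kappa i)) = gauge p (y i) / gauge p (x (kappa i)).
  have [_ yx] := Jy _ Ji; have xi0 : x (kappa i) != 0.
    by rewrite -normr_gt0; apply: lt_le_trans yx; rewrite normr_gt0; case: (Jy _ Ji).
  apply: (canRL (mulfK _)); first by rewrite gauge_eq0.
  by rewrite -gaugeM divfK.
by rewrite -mulrA mulrC.
Qed.

Lemma head_operator_sup x y J kappa u (c : R) :
  (forall j, J j -> y j != 0 /\ `|y j| <= `|x (kappa j)|) ->
  (forall k, `|u k| <= c) -> forall j, `|head_operator x y J kappa u j| <= c.
Proof.
move=> Jy uc j; rewrite /head_operator; case: ifPn => [/set_mem Jj|_]; last first.
  by rewrite normr0; apply: le_trans (uc 0%N).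
have [yj0 yx] := Jy _ Jj; have x0 : 0 < `|x (kappa j)|.
  by apply: lt_le_trans yx; rewrite normr_gt0.
rewrite normrM; apply: le_trans (uc (kappa j)).
rewrite ler_piMl // normrM normfV ler_pdivrMr // mul1r //.
Qed.

Lemma head_operator_eq x y J kappa j :
  (J j -> y j != 0 /\ `|y j| <= `|x (kappa j)|) ->
  head_operator x y J kappa x j = if j \in J then y j else 0.
Proof.
move=> Jy; rewrite /head_operator; case: ifPn => [/set_mem /Jy[yj0 yx]|//].
rewrite divfK // -normr_gt0; apply: lt_le_trans yx.
by rewrite normr_gt0.
Qed.

Section Tail.
Variables (q : R) (x y : nat -> R) (J : set nat) (kappa a b : nat -> nat).

Definition block_mass j := \sum_(a j <= n < b j) gauge q (x (kappa n)).

(** The [j]-th coordinate is an average of the quantities [y j / x k * u k] over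
    the block of [j], all equal to [y j] at [u = x]. *)
Definition tail_operator (u : R^nat) : R^nat := fun j => if j \in J then
  \sum_(a j <= n < b j) gauge q (x (kappa n)) / block_mass j *
    (y j / x (kappa n) * u (kappa n)) else 0.

Hypothesis q1 : 1 <= q.
Hypothesis yN0 : forall j, J j -> y j != 0.
Hypothesis xy : forall j n, J j -> (a j <= n < b j)%N -> `|x (kappa n)| <= `|y j|.
Hypothesis ymass : forall j, J j -> gauge q (y j) <= block_mass j.

Let q0 : 0 < q. Proof. exact: lt_le_trans q1. Qed.

Let mass_gt0 j : J j -> 0 < block_mass j.
Proof. by move=> Jj; apply: lt_le_trans (ymass Jj); exact: gauge_gt0 (yN0 Jj). Qed.

Lemma tail_operator_linear : linear_map tail_operator.
Proof.
move=> c u v; apply/funext => j; rewrite /tail_operator /= !fctE /=.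
case: ifP => _; last by rewrite scaler0 addr0.
rewrite /GRing.scale /= mulr_sumr -big_split /=; apply: eq_bigr => n _.
by rewrite !mulrDr; congr (_ + _); rewrite !mulrA; congr (_ * _); ring.
Qed.

Lemma tail_operator_eq j : tail_operator x j = if j \in J then y j else 0.
Proof.
rewrite /tail_operator; case: ifPn => // /set_mem Jj.
rewrite (eq_bigr (fun n => y j / block_mass j * gauge q (x (kappa n)))) => [|n _].
  by rewrite -mulr_sumr divfK // gt_eqF // mass_gt0.
have [->|xn0] := eqVneq (x (kappa n)) 0; first by rewrite gauge0 !mul0r mulr0.
by rewrite divfK // mulrC mulrA -mulrA mulrCA mulrC.
Qed.

(** The weight of an entry is at most [|x / y|^q], hence at most [|x / y|^r] for
    [r <= q], since [|x| <= |y|] in each block. *)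
Lemma weight_le1 r j n : 0 <= r -> r <= q -> J j -> (a j <= n < b j)%N ->
  gauge q (x (kappa n)) / block_mass j * gauge r (y j / x (kappa n)) <= 1.
Proof.
move=> r0 rq Jj nj; set z := x (kappa n).
have [->|z0] := eqVneq z 0; first by rewrite gauge0 !mul0r.
have zy := xy Jj nj; have y0 := yN0 Jj.
rewrite mulrAC ler_pdivrMr ?mass_gt0 // mul1r; apply: le_trans (ymass Jj).
have {2}-> : y j = z * (y j / z) by rewrite mulrCA divff ?mulr1.
rewrite [leRHS]gaugeM ler_wpM2l ?gauge_ge0 //.
have yz0 : y j / z != 0 by rewrite mulf_neq0 ?invr_eq0.
rewrite !gauge_neq0 // ler_powR //.
by rewrite normrM normfV ler_pdivlMr ?mul1r // normr_gt0.
Qed.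

(** Jensen's inequality when [r >= 1]. When [r <= 1], subadditivity requires the
    matrix entries to be at most 1, which is [weight_le1] at exponent 1: this is
    where [q >= 1] enters. *)
Lemma tail_operator_gauge r u j : 0 <= r -> r <= q -> J j ->
  gauge r (tail_operator u j) <= \sum_(a j <= n < b j) gauge r (u (kappa n)).
Proof.
move=> r0 rq Jj; rewrite /tail_operator mem_set //.
have w0 n : 0 <= gauge q (x (kappa n)) / block_mass j.
  by rewrite divr_ge0 ?gauge_ge0 // ltW // mass_gt0.
have [r1|/ltW r1] := leP r 1.
  apply: le_trans (gauge_sum_subadd _ _ _ _) _; first by rewrite r0.
  rewrite big_nat [leRHS]big_nat; apply: ler_sum => n nj.
  rewrite mulrA gaugeM ler_piMl ?gauge_ge0 // gauge_le1 //.
  rewrite normrM ger0_norm //; have := weight_le1 ler01 q1 Jj nj.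
  by rewrite [gauge 1 _]gaugeE // powRr1.
have rgt0 : 0 < r by apply: lt_le_trans r1.
rewrite gaugeE //; apply: (@le_trans _ _ ((\sum_(a j <= n < b j)
    gauge q (x (kappa n)) / block_mass j * `|y j / x (kappa n) * u (kappa n)|) `^ r)).
  rewrite ge0_ler_powR // ?nnegrE //.
    by apply: sumr_ge0 => n _; rewrite mulr_ge0.
  apply: le_trans (ler_norm_sum _ _ _) _; apply: ler_sum => n _.
  by rewrite normrM (ger0_norm (w0 n)).
apply: le_trans (powR_jensen r1 w0 (fun n => normr_ge0 _) _) _.
  by rewrite -mulr_suml divff // gt_eqF // mass_gt0.
rewrite big_nat [leRHS]big_nat; apply: ler_sum => n nj.
rewrite -gaugeE // gaugeM mulrA ler_piMl ?gauge_ge0 //.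
exact: weight_le1.
Qed.

Hypothesis disj : forall i j n, J i -> J j ->
  (a i <= n < b i)%N -> (a j <= n < b j)%N -> i = j.

Lemma tail_operator_modular r u : 0 <= r -> r <= q ->
  (modular r (tail_operator u) <= \esum_(n in setT) (gauge r (u (kappa n)))%:E)%E.
Proof.
move=> r0 rq; pose I j := [set n | J j /\ (a j <= n < b j)%N].
have g0 n : (0 <= (gauge r (u (kappa n)))%:E)%E by rewrite lee_fin gauge_ge0.
apply: (@le_trans _ _ (\esum_(n in \bigcup_(j in setT) I j) (gauge r (u (kappa n)))%:E)%E);
  last exact: esum_subset.
rewrite esum_bigcupT //; last first.
  by move=> i j _ _ [n [[Ji ni] [Jj nj]]]; exact: disj ni nj.
apply: le_esum => j _; have [Jj|nJ] := pselect (J j); last first.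
  by rewrite /tail_operator memNset // gauge0 esum_ge0.
apply: le_trans (_ : _ <= (\sum_(n <- index_iota (a j) (b j)) gauge r (u (kappa n)))%:E)%E _.
  by rewrite lee_fin; exact: tail_operator_gauge.
apply: sum_le_esum => [n||n]; rewrite ?gauge_ge0 ?iota_uniq //.
by rewrite mem_index_iota.
Qed.

End Tail.

Lemma sum_divn (g : nat -> R) N M : (0 < N)%N ->
  \sum_(0 <= n < M * N) g (n %/ N)%N = N%:R * \sum_(0 <= m < M) g m.
Proof.
move=> N0; elim: M => [|M IH]; first by rewrite mul0n !big_geq // mulr0.
rewrite mulSnr (big_cat_nat (n := (M * N)%N)) ?leq_addr //= IH.
rewrite big_nat_recr //= mulrDr; congr (_ + _).
rewrite big_nat (eq_bigr (fun=> g M)) => [|n /andP[n1 n2]].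
  by rewrite -big_nat sumr_const_nat addKn mulr_natl.
congr g; apply/eqP; rewrite eqn_leq leq_divRL // n1 andbT -ltnS ltn_divLR //.
by rewrite mulSnr.
Qed.

Lemma esum_divn (g : nat -> R) N : (0 < N)%N -> (forall n, 0 <= g n) ->
  (\esum_(n in setT) (g (n %/ N)%N)%:E = N%:R%:E * \esum_(m in setT) (g m)%:E)%E.
Proof.
move=> N0 g0; apply/eqP; rewrite eq_le; apply/andP; split.
  apply: esum_le_ord => // n.
  apply: (@le_trans _ _ (\sum_(0 <= m < n * N) g (m %/ N)%N)%:E).
    rewrite lee_fin -(big_mkord xpredT (fun n => g (n %/ N)%N)).
    rewrite [leRHS](big_cat_nat (n := n)) ?leq_pmulr //= lerDl.
    by apply: sumr_ge0.
  rewrite sum_divn // EFinM lee_wpmul2l ?lee_fin //.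
  by rewrite big_mkord sum_ord_le_esum.
rewrite -esumZl //.
under eq_esum do rewrite -EFinM.
apply: esum_le_ord => [m|n]; first by rewrite mulr_ge0.
rewrite -mulr_sumr -(big_mkord xpredT g) -sum_divn // big_mkord.
exact: (@sum_ord_le_esum _ (fun n => g (n %/ N)%N)).
Qed.

End Operators.

(** * Comparison of K-functionals by levels *)

Section LevelSums.
Context {R : realType}.
Implicit Types (p q s t a b c m eta lam : R) (x y : R^nat).

Lemma Kfun_le (p q : \bar R) (t : R) x0 x1 : lspace p x0 -> lspace q x1 ->
  (Kfun p q t (x0 + x1)%R <= lnorm p x0 + t%:E * lnorm q x1)%E.
Proof. by move=> x0p x1q; apply: ereal_inf_lbound; exists (x0, x1). Qed.

Lemma Kfun_lt (p q : \bar R) (t c : R) y : (0 < t)%R -> (Kfun p q t y < c%:E)%E ->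
  exists y0 y1, [/\ y = y0 + y1, (lnorm p y0 <= c%:E)%E & (lnorm q y1 <= (c / t)%:E)%E].
Proof.
move=> t0 /ereal_inf_lt[_ [[y0 y1] /= [y0p y1q yE] <-] /ltW h].
exists y0, y1; split=> //.
  by apply: le_trans h; rewrite leeDl // mule_ge0 ?lnorm_ge0 // lee_fin ltW.
rewrite EFinM lee_pdivlMr // muleC; apply: le_trans h.
by rewrite leeDr // lnorm_ge0.
Qed.

(** At [t = eta^(1/d) / m] the two terms of the given decomposition of [x] are
    balanced, so a nearly optimal decomposition of [y] for the same [t] satisfies
    both bounds up to constants. *)
Lemma Kfun_transfer p (q : \bar R) lam x y x0 x1 eta m :
  0 <= p -> 0 < lam -> 0 < eta -> 0 < m ->
  (forall t, 0 < t -> (Kfun p%:E q t y <= lam%:E * Kfun p%:E q t x)%E) ->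
  x = x0 + x1 -> (modular p x0 <= eta%:E)%E -> (lnorm q x1 <= m%:E)%E ->
  exists y0 y1, [/\ y = y0 + y1,
    (modular p y0 <= ((3 * lam) `^ mexp p * eta)%:E)%E &
    (lnorm q y1 <= (3 * lam * m)%:E)%E].
Proof.
move=> p0 lam0 eta0 m0 Kyx xE x0eta x1m; set d := mexp p.
have d0 : 0 < d by exact: mexp_gt0.
set rho := eta `^ d^-1; have rho0 : 0 < rho by exact: powR_gt0.
have t0 : 0 < rho / m by exact: divr_gt0.
have Kx : (Kfun p%:E q (rho / m) x <= (2 * rho)%:E)%E.
  have x0rho := lnorm_le_of_modular p0 x0eta.
  have x0p : lspace p%:E x0 by apply/lspace_fin; exists rho.
  have x1q : lspace q x1 by apply/lspace_fin; exists m.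
  rewrite xE; apply: le_trans (Kfun_le _ x0p x1q) _.
  rewrite mulr_natl mulr2n EFinD leeD //.
  apply: le_trans (lee_wpmul2l _ x1m) _; first by rewrite lee_fin ltW.
  by rewrite -EFinM divfK // gt_eqF.
have : (Kfun p%:E q (rho / m) y < (3 * lam * rho)%:E)%E.
  apply: le_lt_trans (Kyx _ t0) _.
  apply: le_lt_trans (lee_wpmul2l _ Kx) _; first by rewrite lee_fin ltW.
  rewrite -EFinM lte_fin mulrA (mulrC lam) -!mulrA ltr_pM2r ?mulr_gt0 //.
  by rewrite ltr_nat.
move=> /(Kfun_lt t0)[y0 [y1 [yE y0le y1le]]]; exists y0, y1; split=> //.
  apply: le_trans (modular_le_of_lnorm p0 y0le) _.
  rewrite lee_fin powRM ?mulr_ge0 ?(ltW lam0) ?(ltW rho0) // /rho -powRrM.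
  by rewrite mulVf ?gt_eqF // powRr1 // ltW.
apply: le_trans y1le _; rewrite lee_fin invf_div mulrA -!mulrA.
by rewrite (mulrCA rho) divff ?mulr1 // gt_eqF.
Qed.

Definition restrict_to (A : set nat) x : R^nat := fun k => if k \in A then x k else 0.

Lemma restrict_toD (A : set nat) x : x = restrict_to A x + restrict_to (~` A) x.
Proof.
apply/funext => k; rewrite !fctE /restrict_to in_setC.
by case: (k \in A); rewrite ?addr0 ?add0r.
Qed.

Lemma modular_restrict p (A : set nat) x :
  (modular p (restrict_to A x) = \esum_(k in A) (gauge p (x k))%:E)%E.
Proof.
rewrite [RHS]esum_mkcond; apply: eq_esum => k _; rewrite /restrict_to.
by case: ifP => // _; rewrite gauge0.
Qed.

Lemma gaugeD_le p a b c : 0 <= p -> `|c| <= `|a| + `|b| -> `|b| <= `|a| ->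
  gauge p c <= 2 `^ p * gauge p a.
Proof.
move=> p0 cab ba; have -> : 2 `^ p = gauge p (2 : R).
  by rewrite gauge_neq0 // ger0_norm.
rewrite -gaugeM ler_gauge // normrM ger0_norm //; lra.
Qed.

(** Cutting [x] at level [s] leaves a remainder of sup norm at most [s], so only
    the entries above [s] count. The matching remainder of [y] is at most
    [3 lam s], half of the entries of [y] considered. *)
Lemma level_domination_oo p lam : 0 <= p -> 0 < lam -> exists2 C : R, 0 < C &
  forall x y, lspace +oo x ->
  (forall t, 0 < t -> (Kfun p%:E +oo t y <= lam%:E * Kfun p%:E +oo t x)%E) ->
  forall s, 0 < s ->
    (\esum_(k in [set k | (6 * lam * s <= `|y k|)%R]) (gauge p (y k))%:E <=
     C%:E * \esum_(k in [set k | (s <= `|x k|)%R]) (gauge p (x k))%:E)%E.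
Proof.
move=> p0 lam0; set C : R := 2 `^ p * (3 * lam) `^ mexp p.
have C0 : 0 < C by rewrite mulr_gt0 // powR_gt0 // mulr_gt0.
exists C => // x y xq Kyx s s0; set A := [set k | s <= `|x k|].
set H := (\esum_(k in A) _)%E.
have H0 : (0 <= H)%E by apply: esum_ge0 => k _; rewrite lee_fin gauge_ge0.
(* [eta] may be any positive bound of [H], as [H] may vanish *)
have key eta : 0 < eta -> (H <= eta%:E)%E ->
    (\esum_(k in [set k | (6 * lam * s <= `|y k|)%R]) (gauge p (y k))%:E <=
     (C * eta)%:E)%E.
  move=> eta0 Heta.
  have [y0 [y1 [yE y0le /lnorm_oo_le y1le]]] : exists y0 y1, [/\ y = y0 + y1,
    (modular p y0 <= ((3 * lam) `^ mexp p * eta)%:E)%E &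
    (lnorm +oo y1 <= (3 * lam * s)%:E)%E].
    apply: (Kfun_transfer p0 lam0 eta0 s0 Kyx (restrict_toD A x)).
      by rewrite modular_restrict.
    apply/lnorm_oo_le => k; rewrite /restrict_to; case: ifPn => [|_].
      by move=> /set_mem /negP; rewrite -ltNge => /ltW.
    by rewrite normr0 ltW.
  apply: (@le_trans _ _ ((2 `^ p)%:E * modular p y0)%E); last first.
    apply: le_trans (lee_wpmul2l _ y0le) _; first by rewrite lee_fin powR_ge0.
    by rewrite -EFinM mulrA.
  rewrite -esumZl ?powR_ge0 // => [|k]; last by rewrite lee_fin gauge_ge0.
  rewrite esum_mkcond; apply: le_esum => k _; case: ifPn => [/set_mem /= yk|_].
    rewrite -EFinM lee_fin (@gaugeD_le p (y0 k) (y1 k)) //.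
      by rewrite yE !fctE ler_normD.
    have := y1le k; have : `|y k| <= `|y0 k| + `|y1 k| by rewrite yE !fctE ler_normD.
    by move: yk; lra.
  by rewrite mule_ge0 // lee_fin ?powR_ge0 ?gauge_ge0.
move: H0 key; case: H => [h| |] // h0 key; last first.
  by rewrite gt0_muley ?lte_fin // leey.
apply/lee_addgt0Pr => e e0; rewrite -EFinM -EFinD.
have -> : C * h + e = C * (h + e / C) by rewrite mulrDr (mulrC C (e / C)) divfK // gt_eqF.
have eC0 : 0 < e / C by exact: divr_gt0.
apply: key; first by apply: ltr_wpDl => //; rewrite -lee_fin.
by rewrite lee_fin lerDl ltW.
Qed.

(** Up to constants, this is the infimum of
    [modular p x0 + s^(p - q) modular q x1] over the decompositions
    [x = x0 + x1]: the minimization is done coordinate by coordinate, and the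
    optimal choice is to put the entries above [s] in [x0]. *)
Definition level_sum p q s x : \bar R :=
  \esum_(k in [set: nat]) (Num.min (gauge p (x k)) (s `^ (p - q) * gauge q (x k)))%:E.

Lemma level_term_ge0 p q s a : 0 <= Num.min (gauge p a) (s `^ (p - q) * gauge q a).
Proof. by rewrite le_min gauge_ge0 mulr_ge0 ?powR_ge0 ?gauge_ge0. Qed.

Lemma gauge_split p q a : a != 0 -> gauge p a = `|a| `^ (p - q) * gauge q a.
Proof.
by move=> a0; rewrite !gauge_neq0 // -powRD ?subrK // normr_eq0 a0 implybT.
Qed.

Lemma ler_npowR p q s t : p <= q -> 0 < s -> s <= t -> t `^ (p - q) <= s `^ (p - q).
Proof.
move=> pq s0 st; have t0 := lt_le_trans s0 st.
rewrite -(opprB q p) !powRN lef_pV2 ?posrE ?powR_gt0 //.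
by rewrite ge0_ler_powR ?subr_ge0 ?nnegrE // ltW.
Qed.

Lemma level_minl p q s a : p <= q -> 0 < s -> s <= `|a| ->
  gauge p a <= s `^ (p - q) * gauge q a.
Proof.
move=> pq s0 sa; have a0 : a != 0 by rewrite -normr_gt0 (lt_le_trans s0).
by rewrite (gauge_split p q a0) ler_wpM2r ?gauge_ge0 // ler_npowR.
Qed.

Lemma level_minr p q s a : p <= q -> 0 < s -> `|a| <= s ->
  s `^ (p - q) * gauge q a <= gauge p a.
Proof.
move=> pq s0 sa; have [->|a0] := eqVneq a 0; first by rewrite !gauge0 mulr0.
by rewrite (gauge_split p q a0) ler_wpM2r ?gauge_ge0 // ler_npowR // normr_gt0.
Qed.

(** The optimal decomposition of [x] at level [s] is carried over to [y] by
    [Kfun_transfer], and any decomposition of [y] bounds its level sum. *)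
Lemma level_sum_domination p q lam : 0 <= p -> p < q -> 0 < lam ->
  exists2 C : R, 0 < C & forall x y, lspace q%:E x ->
  (forall t, 0 < t -> (Kfun p%:E q%:E t y <= lam%:E * Kfun p%:E q%:E t x)%E) ->
  forall s, 0 < s -> (level_sum p q s y <= C%:E * level_sum p q s x)%E.
Proof.
move=> p0 pq lam0; have q0 : 0 < q by exact: le_lt_trans pq.
set C : R := 2 `^ p * (3 * lam) `^ mexp p + 2 `^ q * (3 * lam) `^ q.
have C0 : 0 < C by rewrite addr_gt0 // mulr_gt0 // powR_gt0 // mulr_gt0.
exists C => // x y xq Kyx s s0; set A := [set k | s <= `|x k|].
have qE : mexp q = q by rewrite /mexp gt_eqF.
set H := level_sum p q s x.
have H0 : (0 <= H)%E by apply: esum_ge0 => k _; rewrite lee_fin level_term_ge0.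
have sE : s `^ (p - q) * s `^ (q - p) = 1.
  by rewrite -powRD ?(gt_eqF s0) ?implybT // addrA subrK subrr powRr0.
have key eta : 0 < eta -> (H <= eta%:E)%E -> (level_sum p q s y <= (C * eta)%:E)%E.
  move=> eta0 Heta; set m := (s `^ (q - p) * eta) `^ q^-1.
  have m0 : 0 < m by rewrite powR_gt0 // mulr_gt0 // powR_gt0.
  have [y0 [y1 [yE y0le y1le]]] : exists y0 y1, [/\ y = y0 + y1,
    (modular p y0 <= ((3 * lam) `^ mexp p * eta)%:E)%E &
    (lnorm q%:E y1 <= (3 * lam * m)%:E)%E].
    apply: (Kfun_transfer p0 lam0 eta0 m0 Kyx (restrict_toD A x)).
      apply: le_trans Heta; rewrite modular_restrict esum_mkcond; apply: le_esum => k _.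
      case: ifPn => [/set_mem sx|_]; last by rewrite lee_fin level_term_ge0.
      by rewrite lee_fin le_min lexx level_minl // ltW.
    have -> : m = (s `^ (q - p) * eta) `^ (mexp q)^-1 by rewrite qE.
    apply: (lnorm_le_of_modular (ltW q0)).
    apply: (@le_trans _ _ ((s `^ (q - p))%:E * H)%E); last first.
      by rewrite EFinM lee_wpmul2l // lee_fin powR_ge0.
    rewrite -esumZl ?powR_ge0 // => [|k]; last by rewrite lee_fin level_term_ge0.
    rewrite modular_restrict esum_mkcond; apply: le_esum => k _.
    case: ifPn => [/set_mem /negP|_]; last first.
      by rewrite -EFinM lee_fin mulr_ge0 ?powR_ge0 ?level_term_ge0.
    rewrite -ltNge => /ltW xs; rewrite -EFinM lee_fin (min_idPr _).
      by rewrite mulrA (mulrC (_ `^ _)) sE mul1r.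
    by rewrite level_minr // ltW.
  have {}y1le : (modular q y1 <= ((3 * lam) `^ q * (s `^ (q - p) * eta))%:E)%E.
    apply: le_trans (modular_le_of_lnorm (ltW q0) y1le) _.
    rewrite lee_fin qE powRM ?(ltW m0) ?mulr_ge0 ?(ltW lam0) // /m -powRrM.
    by rewrite mulVf ?gt_eqF // powRr1 // mulr_ge0 ?powR_ge0 // ltW.
  apply: (@le_trans _ _ ((2 `^ p)%:E * modular p y0 +
      (2 `^ q * s `^ (p - q))%:E * modular q y1)%E); last first.
    rewrite /C mulrDl EFinD; apply: leeD.
      apply: le_trans (lee_wpmul2l _ y0le) _; first by rewrite lee_fin powR_ge0.
      by rewrite -EFinM mulrA.
    apply: le_trans (lee_wpmul2l _ y1le) _.
      by rewrite lee_fin mulr_ge0 ?powR_ge0.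
    rewrite -EFinM lee_fin le_eqVlt; apply/orP; left; apply/eqP.
    transitivity (2 `^ q * (3 * lam) `^ q * eta * (s `^ (p - q) * s `^ (q - p))).
      by ring.
    by rewrite sE mulr1.
  rewrite -!esumZl ?mulr_ge0 ?powR_ge0 //; last 2 first.
  - by move=> k; rewrite lee_fin gauge_ge0.
  - by move=> k; rewrite lee_fin gauge_ge0.
  rewrite -esumD; last 2 first.
  - by move=> k _; rewrite -EFinM lee_fin mulr_ge0 ?powR_ge0 ?gauge_ge0.
  - by move=> k _; rewrite -EFinM lee_fin !mulr_ge0 ?powR_ge0 ?gauge_ge0.
  apply: le_esum => k _; rewrite -!EFinM -EFinD lee_fin.
  have yk : `|y k| <= `|y0 k| + `|y1 k| by rewrite yE !fctE ler_normD.
  have [y10|/ltW y01] := leP `|y1 k| `|y0 k|.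
    apply: (@le_trans _ _ (gauge p (y k))); first by rewrite ge_min lexx.
    apply: le_trans (gaugeD_le p0 yk y10) _.
    by rewrite lerDl !mulr_ge0 ?powR_ge0 ?gauge_ge0.
  apply: (@le_trans _ _ (s `^ (p - q) * gauge q (y k))); first by rewrite ge_min lexx orbT.
  rewrite addrC in yk; have := gaugeD_le (ltW q0) yk y01.
  move/(ler_wpM2l (powR_ge0 s (p - q))); rewrite mulrA (mulrC (s `^ _) (2 `^ _)) => h.
  by apply: le_trans h _; rewrite lerDr mulr_ge0 ?powR_ge0 ?gauge_ge0.
have Hfin : (H < +oo)%E.
  move/(lspace_modular _ (ltW q0)) : xq => xq.
  apply: (@le_lt_trans _ _ ((s `^ (p - q))%:E * modular q x)%E); last first.
    by rewrite lte_mul_pinfty ?lee_fin ?powR_ge0.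
  rewrite -esumZl ?powR_ge0 // => [|k]; last by rewrite lee_fin gauge_ge0.
  by apply: le_esum => k _; rewrite -EFinM lee_fin ge_min lexx orbT.
move: H0 Hfin key; case: H => [h| |] // h0 _ key.
apply/lee_addgt0Pr => e e0; rewrite -EFinM -EFinD.
have -> : C * h + e = C * (h + e / C) by rewrite mulrDr (mulrC C (e / C)) divfK // gt_eqF.
have eC0 : 0 < e / C by exact: divr_gt0.
apply: key; first by apply: ltr_wpDl => //; rewrite -lee_fin.
by rewrite lee_fin lerDl ltW.
Qed.

(** A level sum is the sum of a head and a tail; whichever is larger for [x]
    bounds both the head and the tail of [y]. *)
Lemma level_dichotomy p q (C : R) x y s : p <= q -> 0 < C -> 0 < s ->
  (level_sum p q s y <= C%:E * level_sum p q s x)%E ->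
  (\esum_(k in [set k | (s <= `|y k|)%R]) (gauge p (y k))%:E <= (2 * C)%:E *
    \esum_(k in [set k | (s <= `|x k|)%R]) (gauge p (x k))%:E)%E \/
  (\esum_(k in [set k | (`|y k| <= s)%R]) (gauge q (y k))%:E <= (2 * C)%:E *
    \esum_(k in [set k | (`|x k| <= s)%R]) (gauge q (x k))%:E)%E.
Proof.
move=> pq C0 s0; set S := s `^ (p - q); have S0 : 0 < S by exact: powR_gt0.
set hy := (\esum_(k in [set k | (s <= `|y k|)%R]) _)%E.
set hx := (\esum_(k in [set k | (s <= `|x k|)%R]) _)%E.
set ty := (\esum_(k in [set k | (`|y k| <= s)%R]) _)%E.
set tx := (\esum_(k in [set k | (`|x k| <= s)%R]) _)%E => dom.
have hyH : (hy <= level_sum p q s y)%E.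
  rewrite /hy esum_mkcond; apply: le_esum => k _.
  case: ifPn => [/set_mem /= sy|_]; last by rewrite lee_fin level_term_ge0.
  by rewrite lee_fin le_min lexx level_minl.
have tyH : (S%:E * ty <= level_sum p q s y)%E.
  rewrite -esumZl ?(ltW S0) // => [|k]; last by rewrite lee_fin gauge_ge0.
  rewrite esum_mkcond; apply: le_esum => k _.
  case: ifPn => [/set_mem /= sy|_]; last by rewrite lee_fin level_term_ge0.
  by rewrite -EFinM lee_fin le_min lexx level_minr.
have Hx : (level_sum p q s x <= hx + S%:E * tx)%E.
  rewrite -esumZl ?(ltW S0) // => [|k]; last by rewrite lee_fin gauge_ge0.
  rewrite /hx (esum_mkcond [set k | s <= `|x k|]) (esum_mkcond [set k | `|x k| <= s]).
  rewrite -esumD; last 2 first.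
  - by move=> k _; case: ifP => // _; rewrite lee_fin gauge_ge0.
  - by move=> k _; case: ifP => // _; rewrite -EFinM lee_fin mulr_ge0 ?gauge_ge0 ?(ltW S0).
  apply: le_esum => k _; have [sx|/ltW xs] := leP s `|x k|.
    rewrite mem_set //=; apply: (@le_trans _ _ (gauge p (x k))%:E).
      by rewrite lee_fin ge_min lexx.
    rewrite leeDl //; case: ifP => // _; rewrite -EFinM lee_fin mulr_ge0 ?gauge_ge0 //.
    exact: ltW.
  rewrite (mem_set (_ : [set k | `|x k| <= s] k)) //=.
  apply: (@le_trans _ _ (S * gauge q (x k))%:E).
    by rewrite lee_fin ge_min lexx orbT.
  by rewrite EFinM leeDr //; case: ifP => // _; rewrite lee_fin gauge_ge0.
have C0' : (0 <= C%:E)%E by rewrite lee_fin ltW.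
have two (a : \bar R) : ((2 * C)%:E * a = C%:E * (2%:E * a))%E.
  by rewrite muleA -EFinM (mulrC C).
have [th|ht] := leP (S%:E * tx)%E hx.
  left; apply: le_trans hyH _; apply: le_trans dom _; rewrite two lee_wpmul2l //.
  by apply: le_trans Hx _; rewrite mule_natl mule2n leeD2l.
right; rewrite -(@lee_pmul2l _ S%:E) ?lte_fin //.
apply: le_trans tyH _; apply: le_trans dom _; rewrite muleCA two lee_wpmul2l //.
apply: le_trans Hx _; rewrite mule_natl mule2n leeD2r //.
exact: ltW.
Qed.

End LevelSums.

(** * Factorization through a bounded operator *)

Section Factorization.
Context {R : realType}.
Implicit Types (p q lam C : R) (x y : R^nat) (T : R^nat -> R^nat).

Lemma linear_map_on (q : \bar R) T : linear_map T -> linear_on q T.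
Proof. by move=> Tlin a x y _ _. Qed.

Lemma modular_bounded_on p T C : 0 <= p -> 0 <= C ->
  (forall u, (modular p (T u) <= C%:E * modular p u)%E) ->
  bounded_on p%:E T /\ (opnorm p%:E T <= (C `^ (mexp p)^-1)%:E)%E.
Proof.
move=> p0 C0 h; apply: bounded_on_of_le => // u _.
by apply: lnorm_le_scale.
Qed.

Lemma finite_superlevel q x i : 0 <= q -> (modular q x < +oo)%E -> x i != 0 ->
  finite_set [set k | `|x i| <= `|x k|].
Proof.
move=> q0 xq xi0; apply: contrapT => infx.
have : (\esum_(k in [set k | (`|x i| <= `|x k|)%R]) (gauge q (x k))%:E <= modular q x)%E.
  by apply: esum_subset => // k; rewrite lee_fin gauge_ge0.
rewrite (@esum_ge_infinite _ _ _ (fun k => gauge q (x k)) (gauge q (x i))) //.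
- by rewrite leye_eq => /eqP xE; rewrite xE ltxx in xq.
- by move=> k; exact: gauge_ge0.
- exact: gauge_gt0.
- by move=> k /= xk; exact: ler_gauge.
Qed.

Lemma gauge_le_iff q (a b : R) : 0 < q -> (gauge q a <= gauge q b) = (`|a| <= `|b|).
Proof.
move=> q0; apply/idP/idP => [|ab]; last by apply: ler_gauge => //; exact: ltW.
rewrite !gaugeE // !leNgt; apply: contra => ba.
by rewrite gt0_ltr_powR // nnegrE.
Qed.

(** One entry of [x] may have to feed several equal entries of [y], as many as
    [C] allows. Hence each entry of [x] is listed [N] times, by
    [n |-> s (n %/ N)] where [s] enumerates [x] in decreasing order, before the
    entries are matched; [N] absorbs [C]. *)
Lemma tail_factorization q C : 1 <= q -> 0 < C -> exists2 M : R, 0 <= M &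
  forall x y (J : set nat), (modular q x < +oo)%E -> (forall j, J j -> y j != 0) ->
  (forall j, J j ->
    (\esum_(i in [set i | (`|y i| <= `|y j|)%R]) (gauge q (y i))%:E <=
     C%:E * \esum_(k in [set k | (`|x k| <= `|y j|)%R]) (gauge q (x k))%:E)%E) ->
  exists T, [/\ linear_map T, forall j, T x j = if j \in J then y j else 0,
    forall u j, ~ J j -> T u j = 0 &
    forall r u, 0 <= r -> r <= q -> (modular r (T u) <= M%:E * modular r u)%E].
Proof.
move=> q1 C0; have q0 : 0 < q by exact: lt_le_trans q1.
pose N := (Num.trunc (2 * C)).+1; exists N%:R => // x y J xq yJ dom.
have NC : 2 * C <= N%:R by rewrite ltW // truncnS_gt.
have [s [sinj smono ssurj]] : exists s : nat -> nat, [/\ injective s,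
    forall m n, (m <= n)%N -> `|x (s n)| <= `|x (s m)| &
    forall k, 0 < `|x k| -> exists n, s n = k].
  apply: (@decreasing_enumeration _ (fun k => `|x k|)) => // i.
  by rewrite normr_gt0; exact: finite_superlevel (ltW q0) xq.
pose kappa n := s (n %/ N)%N.
have pull (g : nat -> R) : (forall k, 0 <= g k) ->
    (\esum_(n in setT) (g (kappa n))%:E <= N%:R%:E * \esum_(k in setT) (g k)%:E)%E.
  move=> g0; rewrite (@esum_divn _ (fun m => g (s m))) //.
  rewrite lee_wpmul2l ?lee_fin //.
  rewrite -(esum_image setT s (fun k => (g k)%:E)); last by move=> m n _ _; exact: sinj.
  by apply: esum_subset => // k; rewrite lee_fin.
have xfin : (\esum_(n in setT) (gauge q (x (kappa n)))%:E < +oo)%E.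
  apply: le_lt_trans (pull (fun k => gauge q (x k)) _) _ => [k|].
    exact: gauge_ge0.
  by rewrite lte_mul_pinfty ?lee_fin.
have tail j : J j ->
    (2%:E * (\esum_(i in J `&` [set i | (gauge q (y i) <= gauge q (y j))%R])
      (gauge q (y i))%:E) <=
     \esum_(n in [set n | (gauge q (x (kappa n)) <= gauge q (y j))%R])
      (gauge q (x (kappa n)))%:E)%E.
  move=> Jj; pose g k := if `|x k| <= `|y j| then gauge q (x k) else 0.
  have g0 k : 0 <= g k by rewrite /g; case: ifP => // _; exact: gauge_ge0.
  apply: (@le_trans _ _ (N%:R%:E * \esum_(k in setT) (g k)%:E)%E).
    apply: (@le_trans _ _ (2%:E * (C%:E * \esum_(k in setT) (g k)%:E))%E).
      rewrite lee_wpmul2l //.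
      rewrite -(@esum_mkcond_real _ [set k | `|x k| <= `|y j|]) //.
      apply: le_trans (dom _ Jj); apply: esum_subset => [i|i [_ /=]].
        by rewrite lee_fin gauge_ge0.
      by rewrite gauge_le_iff.
    rewrite muleA -EFinM lee_wpmul2r ?lee_fin //.
    by apply: esum_ge0 => k _; rewrite lee_fin.
  rewrite [leRHS](@esum_mkcond_real _ _ (fun n => `|x (kappa n)| <= `|y j|)); last first.
    by move=> n /=; rewrite gauge_le_iff.
  rewrite (@esum_divn _ (fun m => g (s m))) // lee_wpmul2l ?lee_fin //.
  rewrite -(esum_image setT s (fun k => (g k)%:E)); last by move=> m n _ _; exact: sinj.
  rewrite [leRHS]esum_mkcond; apply: le_esum => k _; case: ifPn => // /negP sk.
  rewrite lee_fin /g; have [->|xk0] := eqVneq (x k) 0; first by rewrite gauge0; case: ifP.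
  have [n sn] : exists n, s n = k by apply: ssurj; rewrite normr_gt0.
  by case: sk; rewrite inE; exists n.
have [a [b [abx aby abd]]] := @tail_matching R (fun n => gauge q (x (kappa n)))
  (fun j => gauge q (y j)) J (fun n => gauge_ge0 _ _)
  (fun m n mn => ler_gauge (ltW q0) (smono _ _ (leq_div2r N mn))) xfin
  (fun j Jj => gauge_gt0 _ (yJ _ Jj)) tail.
have abxy j n : J j -> (a j <= n < b j)%N -> `|x (kappa n)| <= `|y j|.
  by move=> Jj nj; rewrite -(gauge_le_iff _ _ q0); exact: abx.
exists (tail_operator q x y J kappa a b); split.
- exact: tail_operator_linear.
- by move=> j; exact: (tail_operator_eq yJ aby).
- by move=> u j nJ; rewrite /tail_operator memNset.
- move=> r u r0 rq; apply: (@le_trans _ _ (\esum_(n in setT) (gauge r (u (kappa n)))%:E)%E).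
    exact: (tail_operator_modular q1 yJ abxy aby abd).
  by apply: (pull (fun k => gauge r (u k))) => k; exact: gauge_ge0.
Qed.

Lemma modularD_disjoint r (u v : R^nat) : (forall k, u k = 0 \/ v k = 0) ->
  (modular r (u + v)%R <= modular r u + modular r v)%E.
Proof.
move=> uv; rewrite -esumD; do ?by move=> k _; rewrite lee_fin gauge_ge0.
apply: le_esum => k _; rewrite -EFinD lee_fin !fctE.
by case: (uv k) => ->; rewrite gauge0 ?add0r ?addr0.
Qed.

Lemma linear_mapD T1 T2 : linear_map T1 -> linear_map T2 ->
  linear_map (fun u => T1 u + T2 u).
Proof. by move=> l1 l2 c u v; rewrite l1 l2 scalerDr addrACA. Qed.

(** The entries of [y] at whose level the heads are comparable are produced by a
    head operator, the others by a tail operator. The two ranges have disjoint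
    supports, so the modulars add up even for [p < 1]. *)
Lemma factorization_fin p q lam : 0 <= p -> p < q -> 1 <= q -> 0 < lam ->
  exists2 M : R, 0 <= M & forall x y, lspace q%:E x ->
  (forall t, 0 < t -> (Kfun p%:E q%:E t y <= lam%:E * Kfun p%:E q%:E t x)%E) ->
  exists T, [/\ couple_op p%:E q%:E T, y = T x &
    (couple_opnorm p%:E q%:E T <= M%:E)%E].
Proof.
move=> p0 pq q1 lam0; have q0 : 0 <= q by apply: le_trans q1.
have [C C0 lev] := level_sum_domination p0 pq lam0.
have C20 : 0 < 2 * C by rewrite mulr_gt0.
have [Mt Mt0 tailf] := tail_factorization q1 C20.
pose M := 2 * C + 2 + Mt; have M0 : 0 <= M by rewrite !addr_ge0 // ltW.
exists (Num.max (M `^ (mexp p)^-1) (M `^ (mexp q)^-1)).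
  by rewrite le_max powR_ge0.
move=> x y xq Kyx.
pose head j := (\esum_(k in [set k | (`|y j| <= `|y k|)%R]) (gauge p (y k))%:E <=
    (2 * C)%:E * \esum_(k in [set k | (`|y j| <= `|x k|)%R]) (gauge p (x k))%:E)%E.
pose JA := [set j | y j != 0 /\ head j]; pose JB := [set j | y j != 0 /\ ~ head j].
have [kappa [kA kload]] : exists kappa : nat -> nat,
    (forall j, JA j -> `|y j| <= `|x (kappa j)|) /\
    forall k, (\esum_(j in JA `&` [set j | kappa j = k]) (gauge p (y j))%:E <=
       ((2 * C + 2) * gauge p (x k))%:E)%E.
  apply: head_matching => //; [exact: ltW|by move=> j []|].
  move=> j [_ hj]; apply: le_trans hj; apply: esum_subset => [k|k [] //].
  by rewrite lee_fin gauge_ge0.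
have xq' : (modular q x < +oo)%E by exact/lspace_modular.
have [j [] //|j [yj0 nh]|Tt [Tlin Teq T0 Tmod]] := tailf x y JB xq'.
  have yj : 0 < `|y j| by rewrite normr_gt0.
  by case: (level_dichotomy (ltW pq) C0 yj (lev x y xq Kyx _ yj)).
have Ay j : JA j -> y j != 0 /\ `|y j| <= `|x (kappa j)|.
  by move=> Jj; split; [case: Jj|exact: kA].
pose T u := head_operator x y JA kappa u + Tt u.
have Tl : linear_map T by apply: linear_mapD => //; exact: head_operator_linear.
have Tm r : p <= r -> r <= q -> forall u, (modular r (T u) <= M%:E * modular r u)%E.
  move=> pr rq u; have r0 := le_trans p0 pr.
  apply: le_trans (modularD_disjoint _ _) _ => [k|].
    have [kJ|kJ] := pselect (JB k); last by right; exact: T0.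
    by left; rewrite /head_operator memNset // => -[_]; case: kJ.
  rewrite EFinD ge0_muleDl ?lee_fin //; last by rewrite addr_ge0 // ltW.
  apply: leeD; last exact: Tmod.
  by apply: (head_operator_modular _ p0) => //; rewrite addr_ge0 // ltW.
have [bp np] := modular_bounded_on p0 M0 (Tm p (lexx p) (ltW pq)).
have [bq nq] := modular_bounded_on q0 M0 (Tm q (ltW pq) (lexx q)).
exists T; split; first by split=> //; exact: linear_map_on.
  apply/funext => j; rewrite /T !fctE Teq head_operator_eq; last exact: Ay.
  have [->|yj0] := eqVneq (y j) 0; first by case: ifP; case: ifP; rewrite addr0.
  have [hj|hj] := pselect (head j).
    by rewrite mem_set // memNset ?addr0 // => -[].
  by rewrite memNset ?add0r ?mem_set // => -[].
rewrite /couple_opnorm ge_max; apply/andP; split.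
  by apply: le_trans np _; rewrite lee_fin le_max lexx.
by apply: le_trans nq _; rewrite lee_fin le_max lexx orbT.
Qed.

(** Dividing [y] by [6 lam] turns the two levels of [level_domination_oo] into
    one, and every entry is produced by a head operator. *)
Lemma factorization_oo p lam : 0 <= p -> 0 < lam ->
  exists2 M : R, 0 <= M & forall x y, lspace +oo x ->
  (forall t, 0 < t -> (Kfun p%:E +oo t y <= lam%:E * Kfun p%:E +oo t x)%E) ->
  exists T, [/\ couple_op p%:E +oo T, y = T x &
    (couple_opnorm p%:E +oo T <= M%:E)%E].
Proof.
move=> p0 lam0; have [C C0 lev] := level_domination_oo p0 lam0.
pose c := 6 * lam; have c0 : 0 < c by rewrite mulr_gt0.
pose D := gauge p c^-1 * C.
have D0 : 0 <= D by rewrite mulr_ge0 ?gauge_ge0 // ltW.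
pose M := gauge p c * (D + 2).
have M0 : 0 <= M by rewrite mulr_ge0 ?gauge_ge0 // addr_ge0.
exists (Num.max (M `^ (mexp p)^-1) c); first by rewrite le_max powR_ge0.
move=> x y xq Kyx; pose z : R^nat := fun j => c^-1 * y j.
have yz j : y j = c * z j by rewrite /z mulrA divff ?mul1r // gt_eqF.
pose J := [set j | z j != 0].
have [kappa [kA kload]] : exists kappa : nat -> nat,
    (forall j, J j -> `|z j| <= `|x (kappa j)|) /\
    forall k, (\esum_(j in J `&` [set j | kappa j = k]) (gauge p (z j))%:E <=
       ((D + 2) * gauge p (x k))%:E)%E.
  apply: head_matching => // j zj0; have zj : 0 < `|z j| by rewrite normr_gt0.
  rewrite EFinM -muleA.
  apply: le_trans (lee_wpmul2l _ (lev x y xq Kyx _ zj)); last first.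
    by rewrite lee_fin gauge_ge0.
  rewrite -esumZl ?gauge_ge0 // => [|k]; last by rewrite lee_fin gauge_ge0.
  rewrite (eq_esum (b := fun k => (gauge p (c^-1))%:E * (gauge p (y k))%:E)%E) => [|k _].
    apply: esum_subset => [k|k [_ /= zk]]; first by rewrite -EFinM lee_fin mulr_ge0 ?gauge_ge0.
    by rewrite (yz k) (normrM c (z k)) (gtr0_norm c0) ler_pM2l.
  by rewrite -EFinM -gaugeM.
have Jz j : J j -> z j != 0 /\ `|z j| <= `|x (kappa j)| by move=> Jj; split=> //; exact: kA.
pose T u := c *: head_operator x z J kappa u.
have Tl : linear_map T.
  move=> a u v; rewrite /T head_operator_linear scalerDr !scalerA.
  by rewrite (mulrC c a).
have [bp np] : bounded_on p%:E T /\ (opnorm p%:E T <= (M `^ (mexp p)^-1)%:E)%E.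
  apply: modular_bounded_on => // u; rewrite EFinM -muleA.
  apply: (@le_trans _ _ ((gauge p c)%:E * modular p (head_operator x z J kappa u))%E).
    rewrite -esumZl ?gauge_ge0 // => [|k]; last by rewrite lee_fin gauge_ge0.
    by apply: le_esum => k _; rewrite -EFinM -gaugeM.
  rewrite lee_wpmul2l ?lee_fin ?gauge_ge0 //.
  by apply: (head_operator_modular _ p0) => //; exact: addr_ge0.
have [bq nq] : bounded_on +oo T /\ (opnorm +oo T <= c%:E)%E.
  apply: bounded_on_of_le => // u /lspace_fin[m um].
  have [n nE] : exists n, lnorm +oo u = n%:E.
    exists (fine (lnorm +oo u)); rewrite fineK // ge0_fin_numE ?lnorm_ge0 //.
    by apply: le_lt_trans um _; rewrite ltry.
  rewrite nE -EFinM; apply/lnorm_oo_le => k; rewrite /T fctE normrM (gtr0_norm c0).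
  rewrite ler_pM2l //; apply: head_operator_sup => // i.
  by have /lnorm_oo_le : (lnorm +oo u <= n%:E)%E by rewrite nE.
exists T; split; first by split=> //; exact: linear_map_on.
  apply/funext => j; rewrite /T fctE head_operator_eq; last exact: Jz.
  have [zj0|zj0] := eqVneq (z j) 0; last by rewrite mem_set // yz.
  by rewrite yz zj0 mulr0; case: ifP; rewrite scaler0.
rewrite /couple_opnorm ge_max; apply/andP; split.
  by apply: le_trans np _; rewrite lee_fin le_max lexx.
by apply: le_trans nq _; rewrite lee_fin le_max lexx orbT.
Qed.

Theorem factorization (p q : \bar R) lam : (0 <= p)%E -> (p < q)%E -> (1 <= q)%E ->
  0 < lam -> exists2 M : R, 0 <= M & forall x y, lspace q x ->
  (forall t, 0 < t -> (Kfun p q t y <= lam%:E * Kfun p q t x)%E) ->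
  exists T, [/\ couple_op p q T, y = T x & (couple_opnorm p q T <= M%:E)%E].
Proof.
case: p => [p| |] // p0; last by case: q.
case: q => [q| |] // pq q1 lam0; last exact: factorization_oo.
exact: factorization_fin.
Qed.

End Factorization.

(** * The case q >= 1 *)

Section UniformCouple.
Context {R : realType}.
Implicit Types (p q : \bar R) (c t lam : R) (x y : R^nat) (T : R^nat -> R^nat).

Lemma Kfun_ge0 p q t x : 0 <= t -> (0 <= Kfun p q t x)%E.
Proof.
move=> t0; apply: le_ereal_inf_tmp => _ [z _ <-].
by rewrite adde_ge0 ?mule_ge0 ?lnorm_ge0.
Qed.

Lemma Kfun_lty p q t x : (0 <= p)%E -> lspace q x -> (Kfun p q t x < +oo)%E.
Proof.
move=> p0 xq; have : (Kfun p q t (0 + x)%R <= lnorm p 0%R + t%:E * lnorm q x)%E.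
  by apply: Kfun_le => //; rewrite /lspace /= lnorm0.
rewrite add0r lnorm0 // add0e => /le_lt_trans; apply.
move: xq (lnorm_ge0 q x); rewrite /lspace /=; case: (lnorm q x) => // r _ _.
by rewrite -EFinM ltry.
Qed.

(** When the denominator vanishes its inverse is [+oo], and a finite quotient
    forces the numerator to vanish. *)
Lemma Kfun_le_Korb_norm p q x y c : (0 <= p)%E -> lspace q x -> 0 <= c ->
  (Korb_norm p q x y <= c%:E)%E ->
  forall t, 0 < t -> (Kfun p q t y <= c%:E * Kfun p q t x)%E.
Proof.
move=> p0 xq c0 yc t t0.
have : (Kfun p q t y / Kfun p q t x <= c%:E)%E.
  by apply: le_trans yc; apply: ereal_sup_ubound; exists t.
have := Kfun_lty t p0 xq; have := Kfun_ge0 p q x (ltW t0).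
have := Kfun_ge0 p q y (ltW t0).
case: (Kfun p q t x) => // r; set k := Kfun p q t y => k0 r0 _.
rewrite inver; case: eqVneq => [->|rN0].
  rewrite mule0; move: k0; rewrite le_eqVlt => /predU1P[<-//|k0].
  by rewrite gt0_muley // leye_eq.
by rewrite lee_pdivrMr // lt_neqAle eq_sym rN0.
Qed.

Lemma lnormZ_le p c x : (0 < p)%E -> 0 <= c ->
  (lnorm p (c *: x)%R <= c%:E * lnorm p x)%E.
Proof.
case: p => [p| |] // p0 c0; last first.
  have [n|h] : lnorm +oo x = +oo%E \/ exists n, lnorm +oo x = n%:E.
    by have := lnorm_ge0 +oo x; case: (lnorm +oo x) => [n _||] //; [right; exists n|left].
    move: c0; rewrite n le_eqVlt => /predU1P[<-|c0].
      by rewrite mul0e scale0r lnorm0.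
    by rewrite gt0_muley ?lte_fin // leey.
  case: h => n nE; rewrite nE -EFinM; apply/lnorm_oo_le => k.
  rewrite fctE normrM (ger0_norm c0) ler_wpM2l //.
  by have /lnorm_oo_le : (lnorm +oo x <= n%:E)%E by rewrite nE.
rewrite lte_fin in p0; have p0' := ltW p0.
have -> : c%:E = ((c `^ p) `^ (mexp p)^-1)%:E.
  by rewrite /mexp gt_eqF // -powRrM divff ?gt_eqF // powRr1.
rewrite !lnormE // -poweR_EFin -poweRM ?modular_ge0 ?lee_fin ?powR_ge0 //.
suff -> : modular p (c *: x)%R = ((c `^ p)%:E * modular p x)%E by [].
rewrite -esumZl ?powR_ge0 // => [|k]; last by rewrite lee_fin gauge_ge0.
apply: eq_esum => k _; rewrite fctE -EFinM gaugeM; congr (_ * _)%:E.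
by rewrite gaugeE // ger0_norm.
Qed.

Lemma Kfun_scale_le p q t c y : (0 < p)%E -> (0 < q)%E -> 0 <= t -> 0 < c ->
  (Kfun p q t (c *: y)%R <= c%:E * Kfun p q t y)%E.
Proof.
move=> p0 q0 t0 c0; rewrite -lee_pdivrMl //.
apply: le_ereal_inf_tmp => _ [[z0 z1] /= [z0p z1q yE] <-].
rewrite lee_pdivrMl // yE scalerDr.
have Z r z : (0 < r)%E -> lspace r z -> lspace r (c *: z).
  move=> r0 /lspace_fin[m zm]; apply/lspace_fin; exists (c * m).
  apply: le_trans (lnormZ_le _ r0 (ltW c0)) _.
  by rewrite EFinM lee_wpmul2l // lee_fin ltW.
apply: le_trans (Kfun_le _ (Z _ _ p0 z0p) (Z _ _ q0 z1q)) _.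
rewrite ge0_muleDr ?mule_ge0 ?lnorm_ge0 //.
apply: leeD; first by apply: lnormZ_le => //; exact: ltW.
rewrite muleCA lee_wpmul2l //; apply: lnormZ_le => //; exact: ltW.
Qed.

Lemma coord_le_lnorm p x k : (0 < p)%E -> (`|x k|%:E <= lnorm p x)%E.
Proof.
move=> p0; have := lnorm_ge0 p x; case E : (lnorm p x) => [n| |] // n0; last by rewrite leey.
case: p p0 E => [p| |] //; last first.
  by move=> _ E; rewrite lee_fin; have /lnorm_oo_le : (lnorm +oo x <= n%:E)%E by rewrite E.
rewrite lte_fin => p0 E; have := gauge_le_modular p x k.
rewrite (modular_poweR _ (ltW p0)) E poweR_EFin lee_fin gaugeE //.
rewrite /mexp gt_eqF // lee_fin => h; rewrite leNgt; apply/negP.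
by move/(gt0_ltr_powR p0 (_ : n \is Num.nneg) (_ : `|x k| \is Num.nneg)); rewrite ltNge h => /(_ n0 (normr_ge0 _)).
Qed.

Lemma Kfun_le0 p q y : (0 < p)%E -> (0 < q)%E -> (Kfun p q 1 y <= 0)%E -> y = 0%R.
Proof.
move=> p0 q0 K0; apply/funext => k; apply/eqP; rewrite -normr_le0.
apply/ler_addgt0Pr => e e0; rewrite add0r; have e2 : 0 < e / 2 by exact: divr_gt0.
have : (Kfun p q 1 y < (e / 2)%:E)%E by apply: le_lt_trans K0 _; rewrite lte_fin.
move=> /(Kfun_lt ltr01)[y0 [y1 [-> y0e]]]; rewrite divr1 => y1e.
rewrite !fctE (le_trans (ler_normD _ _)) // [leRHS]splitr.
apply: lerD; rewrite -lee_fin.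
  exact: le_trans (coord_le_lnorm _ _ p0) y0e.
exact: le_trans (coord_le_lnorm _ _ q0) y1e.
Qed.

Lemma linear_on0 q T : (0 <= q)%E -> linear_on q T -> T 0%R = 0%R.
Proof.
move=> q0 Tl; have q00 : lspace q (0 : R^nat) by rewrite /lspace /= lnorm0.
have := Tl 1 0%R 0%R q00 q00; rewrite !scale1r addr0 => /eqP.
by rewrite -subr_eq subrr eq_sym => /eqP.
Qed.

Lemma couple_op_scale p q T c m : (0 < p)%E -> (0 < q)%E -> 0 <= c -> 0 <= m ->
  couple_op p q T -> (couple_opnorm p q T <= m%:E)%E ->
  couple_op p q (fun u => c *: T u) /\
  (couple_opnorm p q (fun u => c *: T u) <= (m * c)%:E)%E.
Proof.
move=> p0 q0 c0 m0 [Tl Tq Tp] Tm; have T0 := linear_on0 (ltW q0) Tl.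
have S r : (0 < r)%E -> (opnorm r T <= m%:E)%E ->
    bounded_on r (fun u => c *: T u) /\ (opnorm r (fun u => c *: T u) <= (m * c)%:E)%E.
  move=> r0 rm; apply: bounded_on_of_le; first exact: ltW.
  move=> x xr; apply: le_trans (lnormZ_le _ r0 c0) _.
  rewrite (mulrC m) EFinM -muleA lee_wpmul2l ?lee_fin //.
  exact: (lnorm_le_opnorm (ltW r0) T0 m0 rm).
move: Tm; rewrite /couple_opnorm ge_max => /andP[pm qm].
have [bp np] := S _ p0 pm; have [bq nq] := S _ q0 qm.
split; last by rewrite ge_max np nq.
split=> // a x y xq yq; rewrite Tl // scalerDr !scalerA.
by rewrite (mulrC c a).
Qed.

Lemma CM_couple_of_ge1 p q : (0 <= p)%E -> (p < q)%E -> (1 <= q)%E -> CM_couple p q.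
Proof.
move=> p0 pq q1 x xq xN0 y [yq yK].
have [c c0 yc] : exists2 c, 0 < c & (Korb_norm p q x y <= c%:E)%E.
  exists (Num.max 1 (fine (Korb_norm p q x y))); first by rewrite lt_max ltr01.
  move: yK; case: (Korb_norm p q x y) => [r _| |_] //; last by rewrite leNye.
  by rewrite lee_fin le_max lexx orbT.
have [M _ /(_ x y xq)] := factorization p0 pq q1 c0.
move=> /(_ (Kfun_le_Korb_norm p0 xq (ltW c0) yc))[T [TT yT _]].
by exists T.
Qed.

(** For [p > 0] the K-functional is homogeneous, so the factorization is applied
    to [y] divided by its orbit norm; a zero orbit norm forces [y = 0]. *)
Theorem uniform_CM_couple_of_ge1 p q : (0 <= p)%E -> (p < q)%E -> (1 <= q)%E ->
  uniform_CM_couple p q.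
Proof.
move=> p0 pq q1; split; first exact: CM_couple_of_ge1.
have [M M0 fact] := factorization p0 pq q1 ltr01.
case: ifPn => [_|pN0]; exists M.
  move=> x y xq yq Kyx; apply: fact => // t t0; rewrite mul1e; exact: Kyx.
have {p0 pN0}p0 : (0 < p)%E by rewrite lt_neqAle eq_sym pN0.
have q0 : (0 < q)%E by exact: lt_trans pq.
move=> x xq xN0 y [yq yK].
have [r r0 rE] : exists2 r, 0 <= r & Korb_norm p q x y = r%:E.
  have : (0 <= Korb_norm p q x y)%E.
    apply: le_trans (_ : 0 <= Kfun p q 1 y / Kfun p q 1 x)%E _; last first.
      by apply: ereal_sup_ubound; exists 1 => //=.
    by rewrite mule_ge0 ?inve_ge0 ?Kfun_ge0.
  by move: yK; case: (Korb_norm p q x y) => // r _ r0; exists r.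
have Kyx t : 0 < t -> (Kfun p q t y <= r%:E * Kfun p q t x)%E.
  by apply: Kfun_le_Korb_norm => //; [exact: ltW|rewrite rE].
move: r0; rewrite le_eqVlt => /predU1P[r0|r0].
  have y0 : y = 0%R by apply: (@Kfun_le0 p q) => //; have := Kyx _ ltr01; rewrite -r0 mul0e.
  pose T0 : R^nat -> R^nat := fun=> 0.
  have B s : (0 < s)%E -> bounded_on s T0 /\ (opnorm s T0 <= 0%:E)%E.
    by move=> s0; apply: bounded_on_of_le; [exact: ltW|move=> u _; rewrite mul0e lnorm0 // ltW].
  have [bp np] := B _ p0; have [bq nq] := B _ q0.
  exists T0; split=> //; last by rewrite rE -r0 mule0 ge_max np nq.
  by split=> // a u v _ _; rewrite /T0 scaler0 addr0.
have [|T [TT yT TM]] := fact x (r^-1 *: y) xq.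
  move=> t t0; rewrite mul1e; apply: le_trans (Kfun_scale_le _ p0 q0 (ltW t0) _) _.
    by rewrite invr_gt0.
  by rewrite lee_pdivrMl //; exact: Kyx.
have [T'T T'M] := couple_op_scale p0 q0 (ltW r0) M0 TT TM.
exists (fun u => r *: T u); split=> //; last by rewrite rE -EFinM.
by rewrite -yT scalerA divff ?scale1r // gt_eqF.
Qed.

End UniformCouple.

(** * A spread sequence *)

Section Counterexample.
Context {R : realType}.
Implicit Types (p q : R).

(** Cauchy condensation: the block [2^i <= k < 2^(i+1)] of the series
    [sum k^(-a)] contributes at most [(2^(1-a))^i]. *)
Lemma sum_npowR_bounded (a : R) : 1 < a ->
  exists M : R, forall n, \sum_(i < n) i.+1%:R `^ (- a) <= M.
Proof.
move=> a1; pose r : R := 2 `^ (1 - a).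
have r0 : 0 < r by exact: powR_gt0.
have r1 : r < 1.
  have -> : 1 = 2 `^ 0 :> R by rewrite powRr0.
  by rewrite /r /powR !gt_eqF // ltr_expR mul0r pmulr_llt0 ?ln_gt0 ?ltr1n // subr_lt0.
exists (1 - r)^-1 => n.
have block i : \sum_(2 ^ i <= k < 2 ^ i.+1) k%:R `^ (- a) <= r ^+ i.
  apply: (@le_trans _ _ (\sum_(2 ^ i <= k < 2 ^ i.+1) (2 ^+ i) `^ (- a))).
    rewrite big_nat [leRHS]big_nat; apply: ler_sum => k /andP[ik _].
    have k0 : 0 < k%:R :> R by rewrite ltr0n (leq_trans _ ik) // expn_gt0.
    rewrite !powRN lef_pV2 ?posrE ?powR_gt0 ?exprn_gt0 //.
    rewrite ge0_ler_powR ?nnegrE ?exprn_ge0 //; first by rewrite ltW // (lt_trans _ a1).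
    by rewrite -natrX ler_nat.
  rewrite sumr_const_nat expnS mul2n -addnn addnK -[leLHS]mulr_natr natrX.
  rewrite /r -!powR_mulrn // -powRrM (mulrC i%:R) powRrM -powRrM.
  rewrite -powRrM -powRD ?pnatr_eq0 ?implybT //.
  by rewrite le_eqVlt; apply/orP; left; apply/eqP; congr (_ `^ _); ring.
have dyadic i : \sum_(1 <= k < 2 ^ i) k%:R `^ (- a) <= \sum_(j < i) r ^+ j.
  elim: i => [|i IH]; first by rewrite expn0 big_geq // big_ord0.
  rewrite (big_cat_nat (n := (2 ^ i)%N)) ?expn_gt0 ?leq_exp2l //= big_ord_recr /=.
  exact: lerD IH (block i).
apply: (@le_trans _ _ (\sum_(1 <= k < 2 ^ n) k%:R `^ (- a))).
  rewrite -(big_mkord xpredT (fun i => i.+1%:R `^ (- a))) big_add1 /=.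
  rewrite [leRHS](big_cat_nat (n := n)) //=; first last.
    by rewrite -ltnS prednK ?expn_gt0 // ltn_expl.
  by rewrite lerDl sumr_ge0 // => k _; exact: powR_ge0.
apply: le_trans (dyadic n) _.
have r10 : 0 < 1 - r by rewrite subr_gt0.
rewrite -[leRHS]mul1r ler_pdivlMr // mulrC -opprB mulNr -subrX1 opprB.
by rewrite gerBl exprn_ge0 // ltW.
Qed.

Lemma nat_powR_ge (k : R) (x : R) : 0 < k -> exists2 n : nat, (0 < n)%N & x <= n%:R `^ k.
Proof.
move=> k0; exists (Num.trunc (`|x| `^ k^-1)).+1 => //.
apply: le_trans (ler_norm x) _.
have {1}-> : `|x| = (`|x| `^ k^-1) `^ k by rewrite -powRrM mulVf ?gt_eqF // powRr1.
by rewrite ge0_ler_powR ?nnegrE ?powR_ge0 ?(ltW k0) // ltW // truncnS_gt.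
Qed.

(** Take the powers [(m + 1)^(-1/r)] with [p < r < q]: the exponent [q / r > 1]
    gives summability, while the first [K] terms have [p]-th powers adding up to
    at least [K^(1 - p/r)]. *)
Lemma intermediate_sequence p q : 0 <= p -> p < q -> exists b : R^nat,
  [/\ forall m, 0 < b m, forall m n, (m <= n)%N -> b n <= b m,
      (modular q b < +oo)%E &
      forall (A : R) K0, exists2 K, (K0 <= K)%N & A <= \sum_(m < K) gauge p (b m)].
Proof.
move=> p0 pq; pose r := (p + q) / 2; have q0 := le_lt_trans p0 pq.
have r0 : 0 < r by rewrite /r; lra.
have pr : p < r by rewrite /r; lra.
have rq : r < q by rewrite /r; lra.
pose b : R^nat := fun m => m.+1%:R `^ (- r^-1).
have b0 m : 0 < b m by exact: powR_gt0.
have gb s m : gauge s (b m) = m.+1%:R `^ (- (s / r)).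
  by rewrite gauge_neq0 ?gt_eqF // gtr0_norm // -powRrM mulNr mulrC.
have npow_le (s : R) m n : 0 <= s -> (m <= n)%N -> n.+1%:R `^ (- s) <= m.+1%:R `^ (- s).
  move=> s0 mn; rewrite !powRN lef_pV2 ?posrE ?powR_gt0 //.
  by rewrite ge0_ler_powR ?nnegrE // ler_nat ltnS.
exists b; split=> //.
- by move=> m n; apply: npow_le; rewrite invr_ge0 ltW.
- have [|M MP] := @sum_npowR_bounded (q / r); first by rewrite ltr_pdivlMr ?mul1r.
  apply: (@le_lt_trans _ _ M%:E); last by rewrite ltry.
  apply: esum_le_ord => [k|n]; first exact: gauge_ge0.
  by rewrite lee_fin; under eq_bigr do rewrite gb; exact: MP.
move=> A K0; have k0 : 0 < 1 - p / r by rewrite subr_gt0 ltr_pdivrMr ?mul1r.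
have [n n0 nA] := nat_powR_ge A k0; exists (K0 + n)%N; first exact: leq_addr.
apply: (le_trans nA); apply: (@le_trans _ _ (\sum_(m < n) gauge p (b m))); last first.
  rewrite -!(big_mkord xpredT (fun m => gauge p (b m))).
  rewrite [leRHS](big_cat_nat (n := n)) ?leq_addl //= lerDl.
  by apply: sumr_ge0 => k _; exact: gauge_ge0.
apply: (@le_trans _ _ (\sum_(m < n) n%:R `^ (- (p / r)))); last first.
  apply: ler_sum => m _; rewrite gb; case: n n0 nA m => // n _ _ m.
  by apply: npow_le; [rewrite divr_ge0 // ltW|rewrite -ltnS].
rewrite sumr_const card_ord -[leRHS]mulr_natr addrC powRD; last first.
  by rewrite pnatr_eq0 -lt0n n0 implybT.
by rewrite powRr1 // ler0n.
Qed.

(** The common value of [N j] entries whose l^q norm is [b j]. *)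
Definition spread q (b : R^nat) (N : nat -> nat) (j : nat) : R := b j * (N j)%:R `^ (- q^-1).

(** The choice is made one index at a time. First [K j] is taken so large that
    [K j] entries of [b] weigh more in l^p than everything spread before; then
    [b j] is spread so thinly, over [N j] places, that its l^1 norm
    [b j * (N j)^(1 - 1/q)] is negligible against [b (K j)]. The latter is
    possible because [1 / q > 1]. *)
Lemma spreading_data p q (b : R^nat) : 0 <= p -> 0 < q -> q < 1 -> (forall m, 0 < b m) ->
  (forall (A : R) K0, exists2 K, (K0 <= K)%N & A <= \sum_(m < K) gauge p (b m)) ->
  exists K N : nat -> nat, [/\ forall j, (0 < N j)%N,
    forall i j, (i <= j)%N -> (K i <= K j)%N,
    forall j, j.+1%:R * (\sum_(i < j) (N i)%:R * gauge p (spread q b N i)) + 1 <=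
              \sum_(m < K j) gauge p (b m) &
    forall j, (N j)%:R * spread q b N j <= 2^-1 ^+ j.+1 * (b (K j) / j.+1%:R)].
Proof.
move=> p0 q0 q1 b0 bp.
pose A (s : seq (nat * nat)) : R := \sum_(i < size s)
  (nth (0, 0)%N s i).2%:R * gauge p (b i * (nth (0, 0)%N s i).2%:R `^ (- q^-1)).
have [s|f fP] := @history_choice (nat * nat) (fun s KN => [/\ (0 < KN.2)%N,
    forall i, (i < size s)%N -> ((nth (0, 0)%N s i).1 <= KN.1)%N,
    (size s).+1%:R * A s + 1 <= \sum_(m < KN.1) gauge p (b m) &
    KN.2%:R * (b (size s) * KN.2%:R `^ (- q^-1)) <=
      2^-1 ^+ (size s).+1 * (b KN.1 / (size s).+1%:R)]).
  have [K K0 KA] := bp ((size s).+1%:R * A s + 1) (\max_(i < size s) (nth (0, 0)%N s i).1)%N.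
  set e := 2^-1 ^+ (size s).+1 * (b K / (size s).+1%:R).
  have e0 : 0 < e by rewrite mulr_gt0 ?exprn_gt0 ?divr_gt0.
  have k0 : 0 < q^-1 - 1 by rewrite subr_gt0 invf_gt1.
  have [N N0 NP] := nat_powR_ge (b (size s) / e) k0.
  exists (K, N); split=> //= [i si|].
    by apply: leq_trans K0; exact: (leq_bigmax (Ordinal si)).
  have NR : N%:R != 0 :> R by rewrite pnatr_eq0 -lt0n.
  have -> : N%:R * (b (size s) * N%:R `^ (- q^-1)) = b (size s) / N%:R `^ (q^-1 - 1).
    rewrite -powRN opprB powRD ?NR ?implybT // powRr1 //; ring.
  by rewrite ler_pdivrMr ?powR_gt0 ?ltr0n // mulrC -ler_pdivrMr.
pose K j := (f j).1; pose N j := (f j).2.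
have AE j : A (mkseq f j) = \sum_(i < j) (N i)%:R * gauge p (spread q b N i).
  by rewrite /A size_mkseq; apply: eq_bigr => i _; rewrite nth_mkseq.
exists K, N; split=> [j|i j|j|j].
- by case: (fP j).
- rewrite leq_eqVlt => /predU1P[->//|ij]; case: (fP j) => _ + _ _.
  by rewrite size_mkseq => /(_ _ ij); rewrite nth_mkseq.
- by case: (fP j) => _ _ + _; rewrite AE size_mkseq.
- by case: (fP j) => _ _ _; rewrite size_mkseq.
Qed.

End Counterexample.

(** * K-functionals and operators on blocks *)

Section Failure.
Context {R : realType}.
Implicit Types (p q : R) (x y u : R^nat) (phi : nat -> R) (N : nat -> nat).

Lemma gauge_root q (a t : R) : 0 < q -> gauge q a <= t -> `|a| <= t `^ q^-1.
Proof.
move=> q0; rewrite gaugeE // => at_.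
have {1}-> : `|a| = (`|a| `^ q) `^ q^-1 by rewrite -powRrM divff ?gt_eqF // powRr1.
by rewrite ge0_ler_powR ?nnegrE ?powR_ge0 ?invr_ge0 ?(ltW q0) // (le_trans _ at_) ?powR_ge0.
Qed.

(** The unit vectors are mapped into a ball of l^q, which gives the bound for
    finitely supported sequences; the remainder of [u] is small in l^q. *)
Lemma coord_le_l1 q (T : R^nat -> R^nat) (M : R) u m : 0 < q -> 0 <= M ->
  linear_on q%:E T ->
  (forall v, (modular q v < +oo)%E -> (modular q (T v) <= M%:E * modular q v)%E) ->
  (modular q u < +oo)%E ->
  (`|T u m|%:E <= ((M + 1) `^ q^-1)%:E * \esum_(k in setT) `|u k|%:E)%E.
Proof.
move=> q0 M0 Tl Tm uq; set D := (M + 1) `^ q^-1; have q0' := ltW q0.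
have D0 : 0 < D by rewrite powR_gt0 // ltr_wpDl.
pose trunc n := restrict_to [set k | (k < n)%N] u.
have lsp v : (modular q v < +oo)%E -> lspace q%:E v by move/(lspace_modular _ q0').
have truncq n : (modular q (trunc n) < +oo)%E.
  apply: le_lt_trans uq; rewrite modular_restrict.
  by apply: esum_subset => // k; rewrite lee_fin gauge_ge0.
have Tv v t : (modular q v <= t%:E)%E -> `|T v m| <= (M * t) `^ q^-1.
  move=> vt; apply: gauge_root => //; rewrite -lee_fin.
  apply: le_trans (gauge_le_modular _ _ _) _; apply: le_trans (Tm _ _) _.
    by apply: le_lt_trans vt _; rewrite ltry.
  by rewrite EFinM lee_wpmul2l.
pose e n : R^nat := fun k => (k == n)%:R.
have eq1 n : (modular q (e n) <= 1%:E)%E.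
  have -> : modular q (e n) = (\esum_(k in [set n]) 1%:E)%E; last by rewrite esum_set1 ?lee_fin.
  rewrite [RHS]esum_mkcond; apply: eq_esum => k _; rewrite /e.
  case: eqVneq => [->|kn]; first by rewrite mem_set // gauge_neq0 ?oner_eq0 // normr1 powR1.
  by rewrite memNset ?gauge0 // => /= kn'; rewrite kn' eqxx in kn.
have Te n : `|T (e n) m| <= D.
  apply: le_trans (Tv _ _ (eq1 n)) _; rewrite mulr1 ge0_ler_powR ?nnegrE ?invr_ge0 ?lerDl //.
  by rewrite addr_ge0.
have truncS n : trunc n.+1 = u n *: e n + trunc n.
  apply/funext => k; rewrite !fctE /trunc /restrict_to /e /GRing.scale /=.
  have memI i : (k \in [set j | (j < i)%N]) = (k < i)%N.
    by apply/idP/idP => [/set_mem|/mem_set].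
  rewrite !memI ltnS; case: (ltngtP k n) => [_|_|->].
  - by rewrite mulr0 add0r.
  - by rewrite mulr0 add0r.
  - by rewrite mulr1 addr0.
have Ttrunc n : `|T (trunc n) m| <= D * \sum_(k < n) `|u k|.
  elim: n => [|n IH].
    rewrite big_ord0 mulr0 (_ : trunc 0%N = 0); last first.
      by apply/funext => k; rewrite /trunc /restrict_to memNset.
    by rewrite (linear_on0 _ Tl) ?lee_fin // normr0.
  rewrite truncS Tl; [|by apply: lsp; apply: le_lt_trans (eq1 n) _; rewrite ltry|exact: lsp].
  rewrite !fctE (le_trans (ler_normD _ _)) // big_ord_recr /= mulrDr addrC lerD //.
  by rewrite normrM mulrC ler_wpM2r.
apply/lee_addgt0Pr => d d0.
have g0 k : 0 <= gauge q (u k) by exact: gauge_ge0.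
have t0 : 0 < d `^ q / (M + 1) by rewrite divr_gt0 ?powR_gt0 // ltr_wpDl.
have [n /ltW small] := esum_tail_small g0 uq t0.
have rest : (modular q (restrict_to (~` [set k | (k < n)%N]) u) <= (d `^ q / (M + 1))%:E)%E.
  rewrite modular_restrict; apply: le_trans small.
  by apply: esum_subset => // k /= /negP; rewrite -leqNgt.
have uE : u = 1 *: trunc n + restrict_to (~` [set k | (k < n)%N]) u.
  by rewrite scale1r; exact: restrict_toD.
rewrite {1}uE Tl; [|exact: lsp|by apply: lsp; apply: le_lt_trans rest _; rewrite ltry].
rewrite scale1r !fctE; apply: (@le_trans _ _ (D * (\sum_(k < n) `|u k|) + d)%:E).
  rewrite lee_fin (le_trans (ler_normD _ _)) // lerD //.
  apply: le_trans (Tv _ _ rest) _.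
  have {2}-> : d = (d `^ q) `^ q^-1 by rewrite -powRrM divff ?gt_eqF // powRr1 // ltW.
  rewrite ge0_ler_powR ?nnegrE ?invr_ge0 ?powR_ge0 //.
    by rewrite mulr_ge0 // ltW.
  rewrite mulrCA ler_piMr ?powR_ge0 // ler_pdivrMr ?ltr_wpDl // mul1r lerDl //.
by rewrite EFinD leeD2r // EFinM lee_wpmul2l ?lee_fin ?(ltW D0) // sum_ord_le_esum.
Qed.

Lemma sum_ord_esum (f : nat -> R) n : (forall k, 0 <= f k) ->
  ((\sum_(i < n) f i)%:E = \esum_(i in [set i | (i < n)%N]) (f i)%:E)%E.
Proof.
move=> f0; rewrite esum_fset; [|exact: finite_II|by move=> i _; rewrite lee_fin].
by rewrite -(fsbig_ord _ _ (fun i => (f i)%:E)) sumEFin.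
Qed.

Definition code (m i : nat) : nat := choice.pickle (m, i).

Lemma esum_code N (F : nat -> R) : (forall k, 0 <= F k) ->
  (\esum_(m in setT) (\sum_(i < N m) F (code m i))%:E =
   \esum_(k in (fun mi => code mi.1 mi.2) @` [set mi : nat * nat | (mi.2 < N mi.1)%N]) (F k)%:E)%E.
Proof.
move=> F0; rewrite esum_image; last first.
  by move=> [m i] [m' i'] _ _ /(pcan_inj choice.pickleK).
under eq_esum do rewrite (sum_ord_esum _ (fun i => F0 (code _ i))).
rewrite esum_esum => [|m i _ _]; last by rewrite lee_fin.
by congr (esum _ _); apply/seteqP; split=> [[m i] [_ /=]|[m i] /=].
Qed.

Lemma esum_code_le N (F : nat -> R) : (forall k, 0 <= F k) ->
  (\esum_(m in setT) (\sum_(i < N m) F (code m i))%:E <=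
   \esum_(k in setT) (F k)%:E)%E.
Proof. by move=> F0; rewrite esum_code //; apply: esum_subset => // k; rewrite lee_fin. Qed.

(** The value [phi m] repeated [N m] times; the [i]-th copy sits at the code of
    the pair [(m, i)]. *)
Definition blocks N phi : R^nat := fun k =>
  if choice.pickle_inv k is Some (m, i) then if (i < N m)%N then phi m else 0 else 0.

Lemma blocks_code N phi m i : blocks N phi (code m i) = if (i < N m)%N then phi m else 0.
Proof. by rewrite /blocks /code choice.pickleK_inv. Qed.

Lemma blocks_map N phi (f : R -> R) k : f 0 = 0 ->
  f (blocks N phi k) = blocks N (f \o phi) k.
Proof. by move=> f0; rewrite /blocks; case: choice.pickle_inv => [[m i]|//]; case: ifP. Qed.

Lemma blocksD N phi psi : blocks N (phi \+ psi) = blocks N phi + blocks N psi.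
Proof.
apply/funext => k; rewrite !fctE /blocks; case: choice.pickle_inv => [[m i]|]; last by rewrite addr0.
by case: ifP; rewrite ?addr0.
Qed.

Lemma esum_blocks N phi : (forall m, 0 <= phi m) ->
  (\esum_(k in setT) (blocks N phi k)%:E = \esum_(m in setT) ((N m)%:R * phi m)%:E)%E.
Proof.
move=> phi0; have b0 k : 0 <= blocks N phi k.
  by rewrite /blocks; case: choice.pickle_inv => [[m i]|//]; case: ifP.
transitivity (\esum_(m in setT) (\sum_(i < N m) blocks N phi (code m i))%:E)%E; last first.
  apply: eq_esum => m _; congr (_%:E).
  rewrite (eq_bigr (fun=> phi m)) => [|i _]; last by rewrite blocks_code ltn_ord.
  by rewrite sumr_const card_ord mulr_natl.
rewrite esum_code // [RHS]esum_mkcond; apply: eq_esum => k _.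
case: ifPn => // /negP kN; rewrite /blocks; case E : (choice.pickle_inv k) => [[m i]|//].
case: ifPn => // im; case: kN; rewrite inE; exists (m, i) => //.
by have := @choice.pickle_invK (nat * nat)%type k; rewrite E.
Qed.

Lemma modular_blocks r N phi :
  (modular r (blocks N phi) = \esum_(m in setT) ((N m)%:R * gauge r (phi m))%:E)%E.
Proof.
rewrite -esum_blocks => [|m]; last exact: gauge_ge0.
by apply: eq_esum => k _; rewrite (blocks_map _ _ _ (gauge0 r)).
Qed.

Lemma spread_mass q (b : R^nat) N m : 0 < q -> (0 < N m)%N ->
  (N m)%:R * gauge q (spread q b N m) = gauge q (b m).
Proof.
move=> q0 N0; have NR : 0 < (N m)%:R :> R by rewrite ltr0n.
rewrite /spread gaugeM (@gaugeE _ _ (_ `^ _)) // ger0_norm ?powR_ge0 // -powRrM.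
rewrite mulNr mulVf ?gt_eqF // powRN powRr1 ?ltW //.
by rewrite mulrCA divff ?mulr1 // gt_eqF.
Qed.

(** Passing from the spread sequence to the sequence of its block norms is not
    linear, but it respects decompositions: if [x = z0 + z1], then on each block
    one of the two parts carries at least half of the mass of [b]. *)
Lemma Kfun_block_norms p q : 0 <= p -> p < q -> q < 1 -> exists2 c : R, 0 < c &
  forall (b : R^nat) N, (forall j, (0 < N j)%N) -> forall t, 0 < t ->
  (Kfun p%:E q%:E t b <= c%:E * Kfun p%:E q%:E t (blocks N (spread q b N)))%E.
Proof.
move=> p0 pq q1; have q0 : 0 < q by exact: le_lt_trans pq.
pose c : R := Num.max (2 `^ (mexp p)^-1) (2 `^ (mexp q)^-1).
have c0 : 0 < c by rewrite lt_max powR_gt0.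
exists c => // b N N0 t t0; rewrite -lee_pdivrMl //.
apply: le_ereal_inf_tmp => _ [[z0 z1] /= [z0p z1q xE] <-].
rewrite lee_pdivrMl //.
pose mass z m : R := \sum_(i < N m) gauge q (z (code m i)).
have mass0 z m : 0 <= mass z m by apply: sumr_ge0 => i _; exact: gauge_ge0.
have bmass m : gauge q (b m) <= mass z0 m + mass z1 m.
  have -> : gauge q (b m) = \sum_(i < N m) gauge q (blocks N (spread q b N) (code m i)).
    rewrite (eq_bigr (fun=> gauge q (spread q b N m))) => [|i _]; last first.
      by rewrite blocks_code ltn_ord.
    by rewrite sumr_const card_ord -[RHS]mulr_natl spread_mass.
  rewrite /mass -big_split /=; apply: ler_sum => i _; rewrite xE fctE.
  by apply: gauge_subadd; rewrite ltW //= ltW.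
pose A := [set m | mass z1 m <= mass z0 m].
have y0le : (modular p (restrict_to A b) <= 2%:E * modular p z0)%E.
  apply: (@le_trans _ _ (2%:E *
      \esum_(m in setT) (\sum_(i < N m) gauge p (z0 (code m i)))%:E)%E).
    rewrite modular_restrict esum_mkcond -esumZl // => [|m]; last first.
      by rewrite lee_fin sumr_ge0 // => i _; exact: gauge_ge0.
    apply: le_esum => m _; case: ifPn => [/set_mem /= Am|_]; last first.
      by rewrite -EFinM lee_fin mulr_ge0 // sumr_ge0 // => i _; exact: gauge_ge0.
    have pq0 : 0 <= p / q by rewrite divr_ge0 // ltW.
    have pq1 : p / q <= 1 by rewrite ler_pdivrMr // mul1r ltW.
    rewrite -EFinM lee_fin -(gauge_gauge _ p0 q0).
    apply: (@le_trans _ _ (gauge (p / q) (2 * mass z0 m))).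
      apply: ler_gauge => //; rewrite !ger0_norm ?gauge_ge0 ?mulr_ge0 //.
      by apply: le_trans (bmass m) _; rewrite mulr_natl mulr2n lerD2l.
    rewrite gaugeM; apply: ler_pM; rewrite ?gauge_ge0 //.
      rewrite gauge_neq0 // ger0_norm // -[leRHS](powRr1 (ler0n R 2)).
      by rewrite ler_powR // ler1n.
    apply: le_trans (gauge_sum_subadd _ _ _ _) _; first by rewrite pq0.
    by apply: ler_sum => i _; rewrite gauge_gauge.
  rewrite lee_wpmul2l // (esum_code_le N (F := fun k => gauge p (z0 k))) // => k.
  exact: gauge_ge0.
have y1le : (modular q (restrict_to (~` A) b) <= 2%:E * modular q z1)%E.
  apply: (@le_trans _ _ (2%:E * \esum_(m in setT) (mass z1 m)%:E)%E).
    rewrite modular_restrict esum_mkcond -esumZl // => [|m]; last by rewrite lee_fin.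
    apply: le_esum => m _; case: ifPn => [/set_mem /negP|_]; last first.
      by rewrite -EFinM lee_fin mulr_ge0.
    rewrite -ltNge => /ltW Am; rewrite -EFinM lee_fin (le_trans (bmass m)) //.
    by rewrite mulr_natl mulr2n lerD2r.
  rewrite lee_wpmul2l // (esum_code_le N (F := fun k => gauge q (z1 k))) // => k.
  exact: gauge_ge0.
have S r y z : 0 <= r -> 2 `^ (mexp r)^-1 <= c -> (modular r y <= 2%:E * modular r z)%E ->
    (lnorm r%:E y <= c%:E * lnorm r%:E z)%E.
  move=> r0 rc yz; apply: le_trans (lnorm_le_scale r0 _ yz) _ => //.
  by rewrite lee_wpmul2r ?lnorm_ge0.
have L r y z : lspace r%:E z -> (lnorm r%:E y <= c%:E * lnorm r%:E z)%E -> lspace r%:E y.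
  move=> zr yz; apply: le_lt_trans yz _; rewrite lte_mul_pinfty ?lee_fin ?(ltW c0) //.
have n0 := S _ _ _ p0 _ y0le; have n1 := S _ _ _ (ltW q0) _ y1le.
rewrite {}/S in n0 n1.
have {}n0 : (lnorm p%:E (restrict_to A b) <= c%:E * lnorm p%:E z0)%E.
  by apply: n0; rewrite le_max lexx.
have {}n1 : (lnorm q%:E (restrict_to (~` A) b) <= c%:E * lnorm q%:E z1)%E.
  by apply: n1; rewrite le_max lexx orbT.
rewrite {1}(restrict_toD A b).
apply: le_trans (Kfun_le _ (L _ _ _ z0p n0) (L _ _ _ z1q n1)) _.
rewrite ge0_muleDr ?mule_ge0 ?lnorm_ge0 ?lee_fin ?(ltW t0) //.
by apply: leeD => //; rewrite muleCA lee_wpmul2l // lee_fin ltW.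
Qed.

End Failure.

(** * The case q < 1 *)

Section Necessity.
Context {R : realType}.

Lemma sum_halves_le1 n : \sum_(j < n) (2^-1 : R) ^+ j.+1 <= 1.
Proof.
suff -> : \sum_(j < n) (2^-1 : R) ^+ j.+1 = 1 - 2^-1 ^+ n by rewrite gerBl exprn_ge0.
elim: n => [|n IH]; first by rewrite big_ord0 expr0 subrr.
by rewrite big_ord_recr /= IH [2^-1 ^+ n.+1]exprS; field.
Qed.

(** Suppose that [T] maps the spread sequence [x] to [b]. The late blocks of [x]
    are negligible in l^1, so [T] maps them to a sequence with tiny coordinates;
    hence the image of the first [J] blocks is at least [b m / 2] at each
    [m < K J]. By the choice of [K J] its l^p size exceeds that of the first [J]
    blocks by a factor which grows with [J]. *)
Theorem not_CM_couple_lt1 (p q : R) : 0 <= p -> p < q -> q < 1 ->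
  ~ CM_couple p%:E q%:E.
Proof.
move=> p0 pq q1 CM; have q0 : 0 < q by exact: le_lt_trans pq.
have q0' := ltW q0.
have [b [b0 bmono bq bp]] := intermediate_sequence p0 pq.
have [K [N [N0 Kmono KA NA]]] := spreading_data p0 q0 q1 b0 bp.
have [c c0 Kc] := Kfun_block_norms p0 pq q1.
pose s := spread q b N; pose x := blocks N s.
have s0 j : 0 < s j by rewrite mulr_gt0 // powR_gt0 // ltr0n.
have xq : (modular q x < +oo)%E.
  rewrite modular_blocks; apply: le_lt_trans bq; apply: le_esum => m _.
  by rewrite spread_mass.
have xN0 : x <> 0.
  move=> x0; have : x (code 0 0) = 0 by rewrite x0.
  by rewrite /x blocks_code N0 => h; have := s0 0%N; rewrite h ltxx.
have borb : Korb p%:E q%:E x b.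
  split; first exact/lspace_modular.
  apply: (@le_lt_trans _ _ c%:E); last by rewrite ltry.
  apply: ge_ereal_sup => _ [t /= t0 <-]; have := Kc b N N0 t t0.
  have xq' : lspace q%:E x by exact/lspace_modular.
  have := Kfun_lty t (p := p%:E) (q := q%:E) p0 xq'.
  have := Kfun_ge0 p%:E q%:E b (ltW t0); have := Kfun_ge0 p%:E q%:E x (ltW t0).
  rewrite -/s -/x; case: (Kfun _ _ t x) => // r r0 k0 _ kr.
  rewrite inver; case: eqVneq => [rE|rN0]; last first.
    by rewrite lee_pdivrMr // lt_neqAle eq_sym rN0.
  suff -> : Kfun p%:E q%:E t b = 0%E by rewrite mul0e lee_fin ltW.
  by apply/eqP; rewrite eq_le k0 andbT; move: kr; rewrite rE mule0.
have [|T [Tl bdq bdp] bE] := CM x _ xN0 b borb; first exact/lspace_modular.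
have T0 : T 0 = 0 by apply: (linear_on0 _ Tl); rewrite lee_fin.
have bounds r : 0 <= r -> bounded_on r%:E T -> exists2 M : R, 0 <= M &
    forall u, (modular r u < +oo)%E -> (modular r (T u) <= M%:E * modular r u)%E.
  move=> r0 bd; have [m m0 mP] := bounded_on_le (p := r%:E) r0 T0 bd.
  exists (m `^ mexp r) => [|u ur]; first exact: powR_ge0.
  by apply: modular_le_scale => //; apply: mP; exact/lspace_modular.
have [Mp Mp0 MpP] := bounds p p0 bdp; have [Mq Mq0 MqP] := bounds q q0' bdq.
set M' := (Mq + 1) `^ q^-1; have M'0 : 0 <= M' by exact: powR_ge0.
(* an index at which the gains of the construction beat the norms of [T] *)
pose J := Num.trunc (2 * M' + 2 * Mp).
have JM : 2 * M' + 2 * Mp < J.+1%:R by exact: truncnS_gt.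
have J0 : 0 < J.+1%:R :> R by rewrite ltr0n.
pose sl j := if (j < J)%N then s j else 0; pose sr j := if (j < J)%N then 0 else s j.
have xE : x = 1 *: blocks N sl + blocks N sr.
  rewrite scale1r -blocksD; congr (blocks N _); apply/funext => j.
  by rewrite /= /sl /sr; case: ifP; rewrite ?addr0 ?add0r.
have partq (phi : nat -> R) : (forall j, `|phi j| <= s j) -> (modular q (blocks N phi) < +oo)%E.
  move=> phis; apply: le_lt_trans xq; rewrite !modular_blocks; apply: le_esum => m _.
  by rewrite lee_fin ler_wpM2l // ler_gauge // (gtr0_norm (s0 m)).
have slq : (modular q (blocks N sl) < +oo)%E.
  by apply: partq => j; rewrite /sl; case: ifP; rewrite ?normr0 ?(gtr0_norm (s0 j)) ?(ltW (s0 j)).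
have srq : (modular q (blocks N sr) < +oo)%E.
  by apply: partq => j; rewrite /sr; case: ifP; rewrite ?normr0 ?(gtr0_norm (s0 j)) ?(ltW (s0 j)).
set A := \sum_(i < J) (N i)%:R * gauge p (spread q b N i).
have A0 : 0 <= A by apply: sumr_ge0 => i _; rewrite mulr_ge0 ?gauge_ge0.
have slp : modular p (blocks N sl) = A%:E.
  rewrite modular_blocks /A (@sum_ord_esum _ (fun i => (N i)%:R * gauge p (s i))) => [|k].
    rewrite (@esum_mkcond_real _ _ (fun i => (i < J)%N)) //; apply: eq_esum => m _.
    by rewrite /sl; case: ifP => // _; rewrite gauge0 mulr0.
  by rewrite mulr_ge0 ?gauge_ge0.
have sr1 : (\esum_(k in setT) `|blocks N sr k|%:E <= (b (K J) / J.+1%:R)%:E)%E.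
  have bJ0 : 0 <= b (K J) / J.+1%:R by rewrite divr_ge0 // ltW.
  rewrite (eq_esum (b := fun k => (blocks N (fun j => `|sr j|) k)%:E)) => [|k _]; last first.
    by congr (_%:E); exact: (@blocks_map _ N sr Num.norm k (normr0 R)).
  rewrite esum_blocks => [|m]; last exact: normr_ge0.
  apply: (@le_trans _ _ (\esum_(j in setT) (2^-1 ^+ j.+1 * (b (K J) / J.+1%:R))%:E)%E).
    apply: le_esum => j _; rewrite lee_fin /= /sr; case: ltnP => jJ.
      by rewrite normr0 mulr0 mulr_ge0 ?exprn_ge0.
    rewrite (gtr0_norm (s0 j)); apply: le_trans (NA j) _.
    rewrite ler_wpM2l ?exprn_ge0 // ler_pM ?invr_ge0 ?(ltW (b0 _)) //.
      by apply: bmono; exact: Kmono.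
    by rewrite lef_pV2 ?posrE ?ltr0n // ler_nat ltnS.
  apply: esum_le_ord => [k|n]; first by rewrite mulr_ge0 ?exprn_ge0.
  by rewrite lee_fin -mulr_suml ler_piMl // sum_halves_le1.
have Tr m : `|T (blocks N sr) m| <= b (K J) / 2.
  rewrite -lee_fin; apply: le_trans (coord_le_l1 m q0 Mq0 Tl MqP srq) _.
  apply: le_trans (lee_wpmul2l _ sr1) _; first by rewrite lee_fin.
  rewrite -EFinM lee_fin mulrCA ler_pM2l // ler_pdivrMr // mulrC ler_pdivlMr //.
  by rewrite -/M' (mulrC M') (le_trans _ (ltW JM)) // lerDl mulr_ge0.
have Tl_ge m : (m < K J)%N -> gauge p (b m) <= 2 * gauge p (T (blocks N sl) m).
  move=> mK; have bm : b m = T (blocks N sl) m + T (blocks N sr) m.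
    rewrite {1}bE xE Tl ?scale1r //; exact/lspace_modular.
  apply: (@le_trans _ _ (gauge p (2 * T (blocks N sl) m))).
    apply: ler_gauge => //; rewrite normrM (gtr0_norm (b0 m)) ger0_norm //.
    have := Tr m; have := bmono _ _ (ltnW mK); have := b0 m.
    have : `|b m| <= `|T (blocks N sl) m| + `|T (blocks N sr) m| by rewrite {1}bm ler_normD.
    by rewrite (gtr0_norm (b0 m)); lra.
  rewrite gaugeM ler_wpM2r ?gauge_ge0 // gauge_neq0 // ger0_norm //.
  by rewrite -[leRHS](powRr1 (ler0n R 2)) ler_powR ?ler1n // ltW // (lt_trans pq).
have : \sum_(m < K J) gauge p (b m) <= 2 * Mp * A.
  apply: (@le_trans _ _ (2 * \sum_(m < K J) gauge p (T (blocks N sl) m))).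
    by rewrite mulr_sumr; apply: ler_sum => m _; exact: Tl_ge.
  rewrite -mulrA ler_pM2l // -lee_fin EFinM -slp.
  apply: le_trans (MpP _ _); last by rewrite slp ltry.
  by apply: (sum_ord_le_esum (f := fun m => gauge p (T (blocks N sl) m))) => k; exact: gauge_ge0.
have := KA J; rewrite -/A => h1 h2.
have : J.+1%:R * A + 1 <= 2 * Mp * A by exact: le_trans h2.
have : 2 * Mp * A <= J.+1%:R * A.
  by rewrite ler_wpM2r // ltW // (le_lt_trans _ JM) // lerDr mulr_ge0.
lra.
Qed.

Lemma ge1_of_CM_couple (p q : \bar R) : (0 <= p)%E -> (p < q)%E ->
  CM_couple p q -> (1 <= q)%E.
Proof.
case: p => [p| |] // p0; last by case: q.
case: q => [q| |] // pq CM; last by rewrite leey.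
rewrite lee_fin leNgt; apply/negP => q1; exact: not_CM_couple_lt1 CM.
Qed.

End Necessity.

Local Open Scope ereal_scope.

Theorem corollary5p3 (R : realType) (p q : \bar R) (hp : 0 <= p) (hpq : p < q) :
  [<-> CM_couple p q; uniform_CM_couple p q; 1 <= q].
Proof.
tfae.
- by move=> /(ge1_of_CM_couple hp hpq); exact: uniform_CM_couple_of_ge1.
- by move=> [CM _]; exact: ge1_of_CM_couple CM.
- exact: CM_couple_of_ge1.
Qed.
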